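(* Let $q_1,q_2$ be potentials defined on $(0,b_j)$ with $b_j>a$ for $j=1,2$, with associated $m$-functions $m_1,m_2$. Suppose that $q_1=q_2$ on $[0,a]$. Then in the region $\arg(\kappa)\in(-\frac{\pi}{2}+\varepsilon,-\varepsilon)$, $|\kappa|\ge K_0$, we have that $$|m_1(-\kappa^2)-m_2(-\kappa^2)|\le C_{\varepsilon,\delta}\exp(-2a\operatorname{Re}(\kappa)),$$ where $C_{\varepsilon,\delta}$ depends only on $\varepsilon$, $\delta$, and $\sup_{0\le x\le a}\left(\int_x^{x+\delta}|q_j(y)|\,dy\right)$, where $\delta>0$ is any number so that $a+\delta\le b_j$, $j=1,2$.
   Context: Here $a>0$, $\varepsilon>0$, and $K_0$ is a positive constant (the source does not specify it further). Each potential $q=q_j$ on $(0,b)$, $b=b_j$, is real-valued and, with a boundary condition at $b$ where applicable, falls in one of the following cases. Case 1: $b<\infty$, $q\in L^1((0,b))$, and a parameter $h\in\mathbb R\cup\{\infty\}$ is fixed, giving the boundary condition $u'(b_-)+hu(b_-)=0$ (with $h=\infty$ meaning $u(b_-)=0$). In Cases 2–4, $b=\infty$ and $\int_0^R|q(x)|\,dx<\infty$ for all $R<\infty$. Case 2: $\sup_{R>0}\int_R^{R+1}\max(-q(x),0)\,dx<\infty$. Case 3: the condition of Case 2 fails, but $-\frac{d^2}{dx^2}+q$ is limit point at $\infty$, i.e. for each $z$ with $\operatorname{Im}z>0$ the equation $-u''+qu=zu$ has a solution, unique up to a multiplicative constant, that is $L^2$ at $\infty$. Case 4: $-\frac{d^2}{dx^2}+q$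 is limit circle at $\infty$, i.e. every solution of $-u''+qu=zu$ is $L^2$ at $\infty$ if $\operatorname{Im} z>0$; a boundary condition at infinity is picked by picking a nonzero solution $u_0$ of $-u''+qu=iu$, and a function $u$ satisfies the boundary condition if $\lim_{x\to\infty}[u_0(x)u'(x)-u_0'(x)u(x)]=0$. For $\operatorname{Im}z>0$ let $u(x,z)$ be a nonzero solution of $-u''+qu=zu$ satisfying the boundary condition at $b$ (in Cases 2, 3: square integrable near $\infty$); the $m$-function is $m(z)=u'(0_+,z)/u(0_+,z)$.
   Formalization: In Case 4 the boundary condition given by u_0 is assumed self-adjoint: W(conj u_0,u_0) tends to 0 at infinity; for arbitrary u_0 the m-function can have poles and the bound fails. K_0 may depend on a, ε, δ and the suprema; for arbitrary K_0 the constant also depends on a and K_0. *)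

(* Defs.v *)
From mathcomp Require Import all_boot all_order all_algebra.
From mathcomp Require Import all_classical all_reals all_analysis.
From mathcomp Require Import complex.
Import Order.TTheory GRing.Theory Num.Theory.
Import numFieldNormedType.Exports.

Set Implicit Arguments.
Unset Strict Implicit.
Unset Printing Implicit Defensive.

Local Open Scope classical_set_scope.
Local Open Scope complex_scope.
Local Open Scope ring_scope.

Section ComplexValuedFunctions.
Variable R : realType.
Implicit Types (u v : R -> R[i]) (D : set R) (F : set_system R) (l : R[i]).

Local Notation mu := (@lebesgue_measure R).

(* [R[i]] carries no [R]-normed-module structure here, so limits, derivatives
   and integrals of functions R -> R[i] are taken componentwise. *)
Definition clim F u l : Prop :=
  (complex.Re (u x) @[x --> F] --> complex.Re l) /\
  (complex.Im (u x) @[x --> F] --> complex.Im l).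

Definition cderivable u (x : R) : Prop :=
  derivable (fun t => complex.Re (u t)) x 1 /\
  derivable (fun t => complex.Im (u t)) x 1.

Definition cderive u : R -> R[i] := fun x =>
  derive1 (fun t => complex.Re (u t)) x +i* derive1 (fun t => complex.Im (u t)) x.

Definition cintegral D u : R[i] :=
  (\int[mu]_(x in D) complex.Re (u x)) +i* (\int[mu]_(x in D) complex.Im (u x)).

Definition L2_at_infinity u : Prop := exists2 r : R, 0 < r &
  (\int[mu]_(x in `[r, +oo[)
     ((complex.Re (u x)) ^+ 2 + (complex.Im (u x)) ^+ 2)%:E < +oo)%E.

Definition wronskian u v : R -> R[i] :=
  fun x => u x * cderive v x - cderive u x * v x.

End ComplexValuedFunctions.

Section Potentials.
Variable R : realType.
Implicit Types (q : R -> R) (u v : R -> R[i]) (b : \bar R) (z : R[i]).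

Local Notation mu := (@lebesgue_measure R).

(* u is differentiable on (0,b) and u' is the indefinite integral of (q - z) u:
   equivalently, u and u' are locally absolutely continuous on (0,b) and
   - u'' + q u = z u almost everywhere. *)
Definition solution q b z u : Prop :=
  (forall x : R, 0 < x -> (x%:E < b)%E -> cderivable u x) /\
  (forall x y : R, 0 < x -> x <= y -> (y%:E < b)%E ->
     cderive u y - cderive u x
     = cintegral `[x, y] (fun t => ((q t)%:C - z) * u t)).

Definition nonzero_on b u : Prop :=
  exists x : R, [/\ 0 < x, (x%:E < b)%E & u x != 0].

Definition locally_L1 q : Prop :=
  forall r : R, 0 < r -> mu.-integrable `]0, r[ (EFin \o q).

Definition neg_part_unif_L1 q : Prop :=
  (ereal_sup [set \int[mu]_(x in `[r, (r + 1)%R]) (Num.max (- q x) 0)%R%:E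
             | r in [set r : R | (0 < r)%R]] < +oo)%E.

Definition limit_point_at_infinity q : Prop :=
  forall z, 0 < complex.Im z ->
    exists u, [/\ solution q +oo%E z u, nonzero_on +oo%E u, L2_at_infinity u
      & forall v, solution q +oo%E z v -> L2_at_infinity v ->
          exists c : R[i], forall x : R, 0 < x -> v x = c * u x].

Definition limit_circle_at_infinity q : Prop :=
  forall z, 0 < complex.Im z ->
    forall u, solution q +oo%E z u -> L2_at_infinity u.

(* The right end point b, the case the potential falls in, and the boundary
   condition at b.  [RegularEnd b h] is u'(b-) + h u(b-) = 0, where [None]
   stands for h = oo; in the three other cases b = +oo. *)
Variant right_end : Type :=
  | RegularEnd of R & option R
  | BoundedBelowEnd
  | LimitPointEnd
  | LimitCircleEnd of (R -> R[i]).

Definition endpoint (e : right_end) : \bar R :=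
  if e is RegularEnd b _ then b%:E else +oo%E.

(* In the limit circle case the boundary condition defined by u0 is required to
   be a self-adjoint one, i.e. W(conj u0, u0) -> 0.  This is not automatic for a
   solution u0 at the non-real energy i: without it the m-function could be given
   a pole at any prescribed point of the upper half-plane. *)
Definition potential_on q (e : right_end) : Prop :=
  match e with
  | RegularEnd b _ => 0 < b /\ mu.-integrable `]0, b[ (EFin \o q)
  | BoundedBelowEnd => locally_L1 q /\ neg_part_unif_L1 q
  | LimitPointEnd => [/\ locally_L1 q, ~ neg_part_unif_L1 q & limit_point_at_infinity q]
  | LimitCircleEnd u0 =>
      [/\ locally_L1 q, limit_circle_at_infinity q, solution q +oo%E (0 +i* 1) u0,
          nonzero_on +oo%E u0
        & clim +oo%R (wronskian (fun x => (u0 x)^*%C) u0) 0]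
  end.

Definition boundary_condition (e : right_end) u : Prop :=
  match e with
  | RegularEnd b (Some h) => clim b^'- (fun x => cderive u x + h%:C * u x) 0
  | RegularEnd b None => clim b^'- u 0
  | BoundedBelowEnd | LimitPointEnd => L2_at_infinity u
  | LimitCircleEnd u0 => clim +oo%R (wronskian u0 u) 0
  end.

Definition m_function q (e : right_end) (m : R[i] -> R[i]) : Prop :=
  forall z, 0 < complex.Im z ->
    exists u c0 c1, [/\ solution q (endpoint e) z u,
      nonzero_on (endpoint e) u, boundary_condition e u,
      clim 0^'+ u c0 /\ clim 0^'+ (cderive u) c1 & m z = c1 / c0].

Definition sup_local_L1 q (a delta : R) : R :=
  sup [set \int[mu]_(y in `]x, (x + delta)[) `|q y| | x in `[0, a]].

Definition principal_arg (k : R[i]) (theta : R) : Prop :=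
  [/\ k != 0, - pi < theta <= pi & k = `|k| * (cos theta +i* sin theta)].

Definition in_sector (eps : R) (k : R[i]) : Prop :=
  exists2 theta, principal_arg k theta & - (pi / 2) + eps < theta < - eps.

End Potentials.

(* Main.v *)
(* Put z = - k^2.  On the common interval the Wronskian of the two Weyl solutions u1, u2 is
   constant, so m2 - m1 is its value at a, divided by u1(0) u2(0).  The flux Im (conj u u') of a
   Weyl solution decreases in x and does not become negative towards the right end, so it is
   positive everywhere.
   In the sector, positivity of the flux alone gives |u| <= C |A| / |k| and |B| <= C |A| for the
   components A = k u - u' and B = k u + u', which satisfy A' = - k A - q u and B' = k B + q u.
   Gronwall's inequality then makes A decay like exp(- x Re k), and integrating B backwards over
   a window of length delta / 2 improves |B| <= C |A| to |B| = O(|A| / |k|).  As the Wronskian is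
   (A1 B2 - B1 A2) / (2 k), this yields the bound for large |k|.  On bounded ranges of |k| each
   m-function is bounded on its own, because a small u(0) would make the flux lost near 0 exceed
   the flux available there.

   Positivity of the flux rests on the boundary condition: if it failed, the flux would stay
   below some - l < 0 near the right end, which is excluded in each of the four cases. *)

Require Import Defs.
From mathcomp Require Import all_boot all_order all_algebra.
From mathcomp Require Import all_classical all_reals all_analysis.
From mathcomp Require Import complex measurable_realfun ring lra.
Import Order.TTheory GRing.Theory Num.Theory.
Import numFieldNormedType.Exports Normc.

Set Implicit Arguments.
Unset Strict Implicit.
Unset Printing Implicit Defensive.

Local Open Scope classical_set_scope.
Local Open Scope complex_scope.
Local Open Scope ring_scope.

(** * Absolutely continuous primitives *)

Section Primitives.
Variable R : realType.
Implicit Types (f g F G : R -> R) (x y s t r : R).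

Local Notation mu := (@lebesgue_measure R).

(** The powers of |k| decide the argument. Since A + B = 2 k u, the size of A near 0 is comparable
    to |k| |u|. With |B| <= C |A| alone, the Wronskian (A1 B2 - B1 A2) / (2 k) would come out a
    factor |k| too large; the gain of 1 / |k| in B cancels this factor exactly. A is the decaying
    mode and is followed forward from 0. B is the growing mode and is controlled backward from a
    point to the right; at x = a that point lies beyond a, which is why delta enters. The potential
    adds at most about (a / delta + 1) s / |k| to the Gronwall exponent over [0, a]. Beyond a
    threshold depending on a this is at most 1, so the constant there is free of a. Below the
    threshold K the factor exp(- 2 a Re k) is only known to be at least exp(- 2 a K), and a enters
    the constant. As q is merely locally integrable, u' is merely absolutely continuous. Identities
    are therefore stated through increments, in a small calculus of pairs (primitive, density), with
    real and imaginary parts treated separately. *)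

Lemma dist_lt_window (d p r s t : R) : p - d < s -> t < p + d -> s <= r <= t -> `|r - p| < d.
Proof.
move=> ds dt /andP[sr rt]; rewrite ltr_distl.
by rewrite (lt_le_trans ds sr) (le_lt_trans rt dt).
Qed.

Lemma dist_lt_between (a c d p r : R) : a <= r <= c -> `|a - p| < d -> `|c - p| < d -> `|r - p| < d.
Proof.
move=> rac; rewrite !ltr_distl => /andP[pa _] /andP[_ cp].
by have /andP[ar rc] := rac; rewrite (lt_le_trans pa ar) (le_lt_trans rc cp).
Qed.

Lemma dist_le_halves (a c e p : R) : `|a - p| < e / 2 -> `|c - p| < e / 2 -> `|a - c| <= e.
Proof.
by move=> ap; rewrite distrC => pc; rewrite (le_trans (ler_distD p a c)) // [e]splitr ltW ?ltrD.
Qed.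

Definition L1 x y f := mu.-integrable `[x, y] (EFin \o f).

(** An unsigned integral over a set: for [y < x] the interval is empty and the value is 0, so
    additivity needs [x <= y <= s]. *)
Definition int f x y : R := \int[mu]_(r in `[x, y]) f r.

Lemma L1_sub x y s t f : L1 x y f -> x <= s -> t <= y -> L1 s t f.
Proof.
move=> fi xs ty; apply: (integrableS _ _ _ fi) => //.
by apply: subset_itv; rewrite bnd_simp.
Qed.

Lemma L1_ext x y f g : (forall r, x <= r <= y -> f r = g r) -> L1 x y f -> L1 x y g.
Proof.
move=> fg; apply: eq_integrable => // r; rewrite inE /= in_itv /= => rxy.
by rewrite /= fg.
Qed.

Lemma L1_add x y f g : L1 x y f -> L1 x y g -> L1 x y (fun r => f r + g r).
Proof. by move=> fi gi; apply: eq_integrable (integrableD _ fi gi) => //. Qed.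

Lemma L1_sub_fun x y f g : L1 x y f -> L1 x y g -> L1 x y (fun r => f r - g r).
Proof. by move=> fi gi; apply: eq_integrable (integrableB _ fi gi) => //. Qed.

Lemma L1_scale x y k f : L1 x y f -> L1 x y (fun r => k * f r).
Proof. by move=> fi; apply: eq_integrable (integrableZl _ k fi) => //. Qed.

Lemma L1_norm x y f : L1 x y f -> L1 x y (fun r => `|f r|).
Proof. by move=> fi; exact: (integrable_norm fi). Qed.

Lemma within_ball x y F p e : {within `[x, y], continuous F} -> x <= p <= y ->
  0 < e -> exists2 d, 0 < d &
    forall r, x <= r <= y -> `|r - p| < d -> `|F r - F p| < e.
Proof.
move=> /(_ p) cF pxy e0.
have pin : `[x, y]%classic p by rewrite /= in_itv.
have := cF; rewrite /prop_for /continuous_at => /cvgrPdist_lt /(_ e e0).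
rewrite /nbhs /= -(nbhs_subspace_in pin) /within /= => -[d /= d0 H].
exists d => // r rxy rp; rewrite distrC; apply: H => //=.
by rewrite distrC.
Qed.

Lemma ball_within x y F :
  (forall p e, x <= p <= y -> 0 < e -> exists2 d, 0 < d &
    forall r, x <= r <= y -> `|r - p| < d -> `|F r - F p| < e) ->
  {within `[x, y], continuous F}.
Proof.
move=> H p; case: (boolP (x <= p <= y)) => pxy; last first.
  have np : ~ `[x, y]%classic p by rewrite /= in_itv /=; exact/negP.
  rewrite /prop_for /continuous_at; apply/cvgrPdist_lt => e e0.
  suff /= : nbhs_subspace (p : subspace `[x, y]) (fun r => `|F p - F r| < e) by [].
  by rewrite -nbhs_subspace_out // => r ->; rewrite subrr normr0.
have pin : `[x, y]%classic p by rewrite /= in_itv.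
rewrite /prop_for /continuous_at; apply/cvgrPdist_lt => e e0.
suff /= : nbhs_subspace (p : subspace `[x, y]) (fun r => `|F p - F r| < e) by [].
rewrite -(@nbhs_subspace_in R `[x, y]%classic p pin) /within /=.
have [d d0 Hd] := H _ _ pxy e0; exists d => //= r rp.
rewrite in_itv /= => rxy; rewrite distrC; apply: Hd => //.
by rewrite distrC.
Qed.

Lemma continuous_within_itv x y F : (forall r, x <= r <= y -> {for r, continuous F}) ->
  {within `[x, y], continuous F}.
Proof.
move=> H; apply: continuous_in_subspaceT => r; rewrite inE /= in_itv /= => rxy.
exact: H.
Qed.

Lemma cont_L1 x y F : {within `[x, y], continuous F} -> L1 x y F.
Proof. by move=> cF; apply: continuous_compact_integrable => //; exact: segment_compact. Qed.

Lemma L1_mul x y f G : L1 x y f -> {within `[x, y], continuous G} ->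
  L1 x y (fun r => f r * G r).
Proof.
move=> fi cG.
have mG : measurable_fun `[x, y] G by apply: subspace_continuous_measurable_fun.
have bG : [bounded G r | r in `[x, y]].
  have := continuous_compact cG (@segment_compact _ x y) => /compact_bounded.
  move=> [M [Mr HM]]; exists M; split=> // N MN r rxy; apply: HM => //.
by apply: eq_integrable (integrableMl _ fi mG bG) => //.
Qed.

Lemma int_cat x y s f : L1 x s f -> x <= y -> y <= s ->
  int f x s = int f x y + int f y s.
Proof.
move=> fi xy ys; rewrite /int.
have h : mu.-integrable `]y, s] (EFin \o f).
  apply: (integrableS _ _ _ fi) => //.
  by apply: subset_itv; rewrite bnd_simp.
rewrite -[X in _ = _ + X]Rintegral_itv_obnd_cbnd //.
by rewrite -(Rintegral_itvB fi) ?bnd_simp // addrC subrK.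
Qed.

Lemma int_point f x : int f x x = 0.
Proof. by rewrite /int set_itv1 Rintegral_set1. Qed.

Lemma int_ge0 f x y : (forall r, x <= r <= y -> 0 <= f r) -> 0 <= int f x y.
Proof. by move=> H; apply: Rintegral_ge0 => r /=; rewrite in_itv => /H. Qed.

Lemma int_le f g x y : L1 x y f -> L1 x y g ->
  (forall r, x <= r <= y -> f r <= g r) -> int f x y <= int g x y.
Proof.
move=> fi gi H; apply: le_Rintegral => // r /=.
Qed.

Lemma int_ext f g x y : (forall r, x <= r <= y -> f r = g r) -> int f x y = int g x y.
Proof.
by move=> H; apply: eq_Rintegral => r; rewrite inE /= in_itv => /H.
Qed.

Lemma int_add f g x y : L1 x y f -> L1 x y g ->
  int (fun r => f r + g r) x y = int f x y + int g x y.
Proof. by move=> fi gi; apply: RintegralD. Qed.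

Lemma int_subf f g x y : L1 x y f -> L1 x y g ->
  int (fun r => f r - g r) x y = int f x y - int g x y.
Proof. by move=> fi gi; apply: RintegralB. Qed.

Lemma int_scale k f x y : L1 x y f -> int (fun r => k * f r) x y = k * int f x y.
Proof. by move=> fi; apply: RintegralZl. Qed.

Lemma int_norm f x y : L1 x y f -> `|int f x y| <= int (fun r => `|f r|) x y.
Proof. by move=> fi; apply: le_normr_Rintegral. Qed.

Lemma int_cst k x y : x <= y -> int (fun=> k) x y = k * (y - x).
Proof.
move=> xy; rewrite /int Rintegral_cst //=; congr (_ * _).
by rewrite lebesgue_measure_itv /= lte_fin lt_neqAle xy andbT; case: eqVneq => [->|_] /=;
  rewrite ?subrr.
Qed.

Lemma int_subset f x y s t : L1 x y f -> (forall r, x <= r <= y -> 0 <= f r) ->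
  x <= s -> s <= t -> t <= y -> int f s t <= int f x y.
Proof.
move=> fi f0 xs st ty.
rewrite (int_cat fi xs (le_trans st ty)).
rewrite (int_cat (L1_sub fi xs (lexx y)) st ty).
have := @int_ge0 f x s; have := @int_ge0 f t y.
set a := int f x s; set b := int f t y; set c := int f s t.
move=> H1 H2; have : 0 <= a.
  by apply: H2 => r /andP[h1 h2]; apply: f0; rewrite h1 (le_trans h2) // (le_trans st).
have : 0 <= b.
  by apply: H1 => r /andP[h1 h2]; apply: f0; rewrite h2 andbT (le_trans _ h1) // (le_trans xs).
lra.
Qed.

(** Absolute continuity of [F] with density [f], encoded by increments, so that no derivative almost
    everywhere has to be taken. *)
Definition prim x y F f := L1 x y f /\
  forall s t, x <= s -> s <= t -> t <= y -> F t - F s = int f s t.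

Lemma prim_continuous x y F f : prim x y F f -> {within `[x, y], continuous F}.
Proof.
move=> [fi HF].
have [xy|yx] := leP x y; last by rewrite set_itv_ge -?leNgt ?bnd_simp //; exact: continuous_subspace0.
have c := parameterized_integral_continuous xy fi.
apply: ball_within => p e pxy e0.
have [d d0 Hd] := within_ball c pxy e0.
exists d => // r rxy rp; have := Hd r rxy rp.
have /andP[p1 p2] := pxy; have /andP[r1 r2] := rxy.
have -> : F r = F x + int f x r by rewrite -(HF x r) //; ring.
have -> : F p = F x + int f x p by rewrite -(HF x p) //; ring.
by rewrite opprD addrACA subrr add0r.
Qed.

Lemma prim_sub x y s t F f : prim x y F f -> x <= s -> t <= y -> prim s t F f.
Proof.
move=> [fi HF] xs ty; split; first exact: L1_sub fi xs ty.
by move=> a b sa ab bt; apply: HF => //; [exact: le_trans sa | exact: le_trans ty].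
Qed.

Lemma prim_int x y f : L1 x y f -> prim x y (int f x) f.
Proof.
move=> fi; split=> // s t xs st ty.
by rewrite (int_cat (L1_sub fi (lexx x) ty) xs st) addrAC subrr add0r.
Qed.

Lemma prim_le x y F f G g : x <= y -> prim x y F f -> prim x y G g ->
  (forall r, x <= r <= y -> f r <= g r) -> F y - F x <= G y - G x.
Proof. by move=> xy [fi HF] [gi HG] fg; rewrite HF // HG //; exact: int_le. Qed.

Lemma prim_ext x y F f G g : prim x y F f ->
  (forall r, x <= r <= y -> F r = G r) ->
  (forall r, x <= r <= y -> f r = g r) -> prim x y G g.
Proof.
move=> [fi HF] FG fg; split; first exact: L1_ext fi.
move=> s t xs st ty; rewrite -!FG ?HF ?xs ?ty ?(le_trans st) ?(le_trans xs) //.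
by apply: int_ext => r /andP[sr rt]; apply: fg; rewrite (le_trans xs) ?(le_trans rt).
Qed.

Lemma prim_cst x y k : prim x y (fun=> k) (fun=> 0).
Proof.
split; first exact: (@integrable0 _ _ _ mu `[x, y]).
by move=> s t _ st _; rewrite int_cst // mul0r subrr.
Qed.

Lemma prim_id x y : prim x y id (fun=> 1).
Proof.
split; first by apply: cont_L1; apply: continuous_subspaceT => ?; exact: cvg_cst.
by move=> s t _ st _; rewrite int_cst // mul1r.
Qed.

Lemma prim_add x y F f G g : prim x y F f -> prim x y G g ->
  prim x y (fun r => F r + G r) (fun r => f r + g r).
Proof.
move=> [fi HF] [gi HG]; split; first exact: L1_add.
move=> s t xs st ty; rewrite int_add -?HF -?HG //; last first.
- exact: L1_sub gi xs ty.
- exact: L1_sub fi xs ty.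
by ring.
Qed.

Lemma prim_scale x y k F f : prim x y F f ->
  prim x y (fun r => k * F r) (fun r => k * f r).
Proof.
move=> [fi HF]; split; first exact: L1_scale.
move=> s t xs st ty; rewrite int_scale -?HF //; last exact: L1_sub fi xs ty.
by ring.
Qed.

Lemma prim_opp x y F f : prim x y F f -> prim x y (fun r => - F r) (fun r => - f r).
Proof.
by move=> /(prim_scale (-1)) H; apply: prim_ext H _ _ => r _; rewrite mulN1r.
Qed.

Lemma prim_subf x y F f G g : prim x y F f -> prim x y G g ->
  prim x y (fun r => F r - G r) (fun r => f r - g r).
Proof. by move=> HF /prim_opp HG; exact: prim_add. Qed.

(** The supremum [c] of the points [r] with [G x <= G r] is itself such a point and can be passed,
    because the hypothesis at [c] compares a point just left of [c] with [c] and with points just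
    right of it. *)
Lemma local_monotone x y G : x <= y ->
  (forall p, x <= p <= y -> exists2 d, 0 < d &
    forall s t, x <= s <= p -> p <= t <= y -> p - d < s -> t < p + d -> G s <= G t) ->
  G x <= G y.
Proof.
move=> xy H; pose S := [set r | x <= r <= y /\ G x <= G r].
have Sx : S x by rewrite /S /= lexx xy.
have hS : has_sup S.
  by split; [exists x | exists y => r [/andP[]]].
set c := sup S.
have cxy : x <= c <= y.
  rewrite ub_le_sup //=; last by case: hS.
  by apply: ge_sup; [exists x | move=> r [/andP[]]].
have [d d0 Hd] := H c cxy.
have [r Sr cr] := sup_adherent d0 hS.
have rc : r <= c by apply: ub_le_sup => //; case: hS.
have [/andP[xr ry] Gr] := Sr.
have /andP[xc yc] := cxy.
have key t : c <= t <= y -> t < c + d -> G x <= G t.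
  by move=> ct tcd; apply: le_trans Gr _; apply: Hd; rewrite ?xr ?rc.
have [cy|] := ltP c y; last first.
  move=> yc'; have e : c = y by apply/eqP; rewrite eq_le yc yc'.
  by apply: key; rewrite ?e ?lexx //; lra.
pose t := Num.min y (c + d / 2).
have ct : c < t by rewrite /t lt_min cy /=; lra.
have ty : t <= y by rewrite /t ge_min lexx.
have td : t < c + d by rewrite /t gt_min; apply/orP; right; lra.
have St : S t.
  split; first by rewrite ty andbT; lra.
  by apply: key => //; rewrite ty andbT ltW.
by have := ub_le_sup (proj2 hS) St; rewrite leNgt -/c ct.
Qed.

(* A primitive is recognised from its infinitesimal increments: it suffices that the
   error be, near each point, a small multiple of an absolutely continuous measure. *)
Lemma prim_local x y F f g : L1 x y f -> L1 x y g ->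
  (forall p e, x <= p <= y -> 0 < e -> exists2 d, 0 < d &
    forall s t, x <= s <= p -> p <= t <= y -> p - d < s -> t < p + d ->
      `|F t - F s - int f s t| <= e * int g s t) ->
  prim x y F f.
Proof.
move=> fi gi H; split=> // s t xs st ty.
have gst : L1 s t g by exact: L1_sub gi xs ty.
have fst : L1 s t f by exact: L1_sub fi xs ty.
suff K c : c = 1 \/ c = - 1 -> forall e, 0 < e ->
    c * (F t - F s - int f s t) <= e * int g s t.
  suff : `|F t - F s - int f s t| <= 0.
    by rewrite normr_le0 subr_eq0 => /eqP.
  apply/ler_addgt0Pr => e e0; rewrite add0r.
  pose I := `|int g s t| + 1.
  have I0 : 0 < I by rewrite ltr_pwDr.
  have e1 : 0 < e / I by rewrite divr_gt0.
  have le : e / I * int g s t <= e.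
    rewrite -mulrA ler_piMr ?(ltW e0) // mulrC ler_pdivrMr // mul1r.
    by rewrite /I (le_trans (ler_norm _)) // lerDl.
  have h1 := K 1 (or_introl erefl) _ e1.
  have h2 := K (-1) (or_intror erefl) _ e1.
  by rewrite ler_norml; apply/andP; split; lra.
move=> cc e e0.
(* Up to the sign [c], this is the allowed error minus the actual one; the local hypothesis says
   precisely that it does not decrease across any point. *)
pose G r := e * int g s r - c * (F r - F s - int f s r).
suff : G s <= G t.
  by rewrite /G !int_point subrr subr0 !mulr0 subr0 subr_ge0.
apply: local_monotone st _ => p /andP[sp pt].
have pxy : x <= p <= y by rewrite (le_trans xs) ?(le_trans pt).
have [d d0 Hd] := H p e pxy e0.
exists d => // a b /andP[sa ap] /andP[pb bt] da bd.
have := Hd a b; rewrite ap pb (le_trans xs sa) (le_trans bt ty) => /(_ isT isT da bd).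
have ab := le_trans ap pb.
have Eg := int_cat (L1_sub gst (lexx s) bt) sa ab.
have Ef := int_cat (L1_sub fst (lexx s) bt) sa ab.
rewrite /G Eg Ef ler_norml => /andP[].
move: cc; clear; move: (int g s a) (int f s a) (int g a b) (int f a b) (F a) (F b) (F s).
by move=> ? ? ? ? ? ? ? [] -> h1 h2; lra.
Qed.

Lemma int_bound f g k x y : L1 x y f -> L1 x y g -> 
  (forall r, x <= r <= y -> `|f r| <= k * g r) -> `|int f x y| <= k * int g x y.
Proof.
move=> fi gi H; apply: le_trans (int_norm fi) _.
rewrite -int_scale //; apply: int_le => //; [exact: L1_norm | exact: L1_scale].
Qed.

(** With mixed end points the increment is exact: [F t * G t - F s * G s] is the integral of
    [G s * f + F t * g]. The error against the product rule is then governed by the oscillation of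
    [F] and [G] near [p]. *)
Lemma prim_mul x y F f G g : prim x y F f -> prim x y G g ->
  prim x y (fun r => F r * G r) (fun r => f r * G r + F r * g r).
Proof.
move=> PF PG; have cF := prim_continuous PF; have cG := prim_continuous PG.
have [fi HF] := PF; have [gi HG] := PG.
have fGi : L1 x y (fun r => f r * G r) by exact: L1_mul.
have Fgi : L1 x y (fun r => F r * g r).
  by apply: L1_ext (L1_mul gi cF) => r _; rewrite mulrC.
apply: (@prim_local _ _ _ _ (fun r => `|f r| + `|g r|)).
- exact: L1_add.
- by apply: L1_add; apply: L1_norm.
move=> p e pxy e0; have e2 : 0 < e / 2 by lra.
have [d1 d10 Hd1] := within_ball cF pxy e2.
have [d2 d20 Hd2] := within_ball cG pxy e2.
exists (Num.min d1 d2); first by rewrite lt_min d10.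
move=> s t /andP[xs sp] /andP[pt ty].
move=> ds dt.
have dd1 : Num.min d1 d2 <= d1 by rewrite ge_min lexx.
have dd2 : Num.min d1 d2 <= d2 by rewrite ge_min lexx orbT.
have st := le_trans sp pt.
have rp r : s <= r <= t -> `|r - p| < Num.min d1 d2 by exact: dist_lt_window.
have F1 r : s <= r <= t -> `|F r - F p| < e / 2.
  move=> rst; have /andP[h1 h2] := rst.
  apply: Hd1; first by rewrite (le_trans xs) ?(le_trans h2).
  exact: lt_le_trans (rp r rst) dd1.
have G1 r : s <= r <= t -> `|G r - G p| < e / 2.
  move=> rst; have /andP[h1 h2] := rst.
  apply: Hd2; first by rewrite (le_trans xs) ?(le_trans h2).
  exact: lt_le_trans (rp r rst) dd2.
have fst := L1_sub fi xs ty; have gst := L1_sub gi xs ty.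
have fGst := L1_sub fGi xs ty; have Fgst := L1_sub Fgi xs ty.
pose h r := f r * (G s - G r) + g r * (F t - F r).
have hE : F t * G t - F s * G s - int (fun r => f r * G r + F r * g r) s t = int h s t.
  have -> : F t * G t - F s * G s = int (fun r => G s * f r + F t * g r) s t.
    rewrite int_add; [|exact: L1_scale..].
    by rewrite !int_scale // -HF // -HG //; ring.
  rewrite -int_subf; first by apply: int_ext => r _; rewrite /h; ring.
  - by apply: L1_add; exact: L1_scale.
  - exact: L1_add.
rewrite hE; apply: int_bound.
- apply: L1_ext (L1_sub_fun (L1_add (L1_scale (G s) fst) (L1_scale (F t) gst)) (L1_add fGst Fgst)) => r _.
  by rewrite /h; ring.
- by apply: L1_add; apply: L1_norm.
move=> r rst; rewrite /h (le_trans (ler_normD _ _)) // !normrM mulrDr.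
have sst : s <= s <= t by rewrite lexx.
have tst : s <= t <= t by rewrite st lexx.
have k1 : `|G s - G r| <= e by exact: dist_le_halves (G1 _ sst) (G1 _ rst).
have k2 : `|F t - F r| <= e by exact: dist_le_halves (F1 _ tst) (F1 _ rst).
by apply: lerD; rewrite mulrC; apply: ler_wpM2r.
Qed.

(** The mean value theorem for [phi] between [F s] and [F t] turns the increment into [dphi xi]
    times that of [F]; continuity of [dphi] at [F p] makes the error small against the integral of
    [|f|]. The interval [i] accommodates functions such as the inverse, smooth on a half-line
    only. *)
Lemma prim_comp x y F f (i : interval R) (phi dphi : R -> R) :
  prim x y F f -> (forall r, x <= r <= y -> F r \in i) ->
  (forall v, v \in i -> is_derive v 1 phi (dphi v)) ->
  (forall v, v \in i -> {for v, continuous dphi}) ->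
  prim x y (phi \o F) (fun r => dphi (F r) * f r).
Proof.
move=> PF Fi dP cP; have cF := prim_continuous PF; have [fi HF] := PF.
have cd : {within `[x, y], continuous (dphi \o F)}.
  apply: ball_within => p e pxy e0.
  have /cvgrPdist_lt /(_ e e0) [k /= k0 Hk] := cP _ (Fi p pxy).
  have [d d0 Hd] := within_ball cF pxy k0; exists d => // r rxy rp.
  by rewrite distrC; apply: Hk => /=; rewrite distrC; exact: Hd.
have dfi : L1 x y (fun r => dphi (F r) * f r).
  by apply: L1_ext (L1_mul fi cd) => r _; rewrite mulrC.
apply: (@prim_local _ _ _ _ (fun r => `|f r|)) => //; first exact: L1_norm.
move=> p e pxy e0; have e2 : 0 < e / 2 by lra.
have /cvgrPdist_lt /(_ _ e2) [k /= k0 Hk] := cP _ (Fi p pxy).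
have [d d0 Hd] := within_ball cF pxy k0; exists d => //.
move=> s t /andP[xs sp] /andP[pt ty] ds dt.
have st := le_trans sp pt.
have in_xy r : s <= r <= t -> x <= r <= y.
  by move=> /andP[h1 h2]; rewrite (le_trans xs) ?(le_trans h2).
have F1 r : s <= r <= t -> `|F r - F p| < k.
  move=> rst; apply: Hd; first exact: in_xy.
  exact: dist_lt_window ds dt rst.
have D1 v : `|v - F p| < k -> `|dphi v - dphi (F p)| < e / 2.
  by move=> vk; rewrite distrC; apply: Hk => /=; rewrite distrC.
have sst : s <= s <= t by rewrite lexx.
have tst : s <= t <= t by rewrite st lexx.
have [xi [xi1 xi2]] : exists xi, `|xi - F p| < k /\
    phi (F t) - phi (F s) = dphi xi * (F t - F s).
  have Fs := F1 _ sst; have Ft := F1 _ tst.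
  have is_ := Fi _ (in_xy _ sst); have it := Fi _ (in_xy _ tst).
  have K a b : a <= b -> a \in i -> b \in i -> `|a - F p| < k -> `|b - F p| < k ->
      exists xi, `|xi - F p| < k /\ phi b - phi a = dphi xi * (b - a).
    move=> ab ai bi ak bk.
    have sub v : v \in `[a, b] -> v \in i.
      rewrite in_itv /= => /andP[av vb].
      case: (i) ai bi => l u; rewrite !itv_boundlr => /andP[la _] /andP[_ bu].
      rewrite (le_trans la) ?bnd_simp //=; apply: le_trans bu.
      by rewrite bnd_simp.
    have [||c /[1!in_itv] /= /andP[ac cb] ->] := @MVT_segment R phi dphi a b ab.
    - by move=> v vab; apply: dP; apply: sub; exact: subset_itv_oo_cc.
    - apply: derivable_within_continuous => v /sub /dP [] //.
    exists c; split=> //.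
    by apply: dist_lt_between ak bk; rewrite ac.
  have [le|/ltW le] := leP (F s) (F t); first exact: K.
  have [c [c1 c2]] := K _ _ le it is_ Ft Fs.
  by exists c; split=> //; rewrite -opprB c2 -mulrN opprB.
have fst := L1_sub fi xs ty; have dfst := L1_sub dfi xs ty.
have -> : (phi \o F) t - (phi \o F) s - int (fun r => dphi (F r) * f r) s t =
    int (fun r => dphi xi * f r - dphi (F r) * f r) s t.
  by rewrite int_subf //= ?xi2 ?HF ?int_scale //; exact: L1_scale.
apply: int_bound.
- by apply: L1_sub_fun => //; exact: L1_scale.
- exact: L1_norm.
move=> r rst; rewrite -mulrBl normrM ler_wpM2r //.
exact: dist_le_halves (D1 _ xi1) (D1 _ (F1 _ rst)).
Qed.

(** The chain rule with the identity as inner primitive. *)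
Lemma prim_derive x y F f :
  (forall r, x <= r <= y -> is_derive r 1 F (f r)) ->
  (forall r, x <= r <= y -> {for r, continuous f}) -> prim x y F f.
Proof.
move=> dF cf.
have H := @prim_comp x y id _ `[x, y]%R F f (prim_id x y).
apply: prim_ext (H _ _ _) _ _ => //=.
- by move=> r; rewrite mulr1.
Qed.

Lemma prim_is_derive x y F f r : prim x y F f -> x < r -> r < y ->
  {for r, continuous f} -> is_derive r 1 F (f r).
Proof.
move=> [fi HF] xr ry cf.
have [dI eI] := continuous_FTC1_closed ry fi xr cf.
have nE : {near r, (fun t => F x + int f x t) =1 F}.
  have : \forall t \near r, t \in `]x, y[ by apply: near_in_itvoo; rewrite in_itv /= xr.
  apply: filterS => t; rewrite in_itv /= => /andP[xt ty].
  by rewrite -(HF x t (lexx x) (ltW xt) (ltW ty)); ring.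
have I : is_derive r 1 (int f x) (f r).
  by apply: (DeriveDef dI); rewrite -derive1E.
have I2 : is_derive r 1 (fun t => F x + int f x t) (f r).
  by rewrite -[X in is_derive _ _ _ X]add0r; exact: is_deriveD.
by apply: near_eq_is_derive I2 => //; exact: oner_neq0.
Qed.

Lemma prim_exp x y F f : prim x y F f ->
  prim x y (fun r => expR (F r)) (fun r => expR (F r) * f r).
Proof.
move=> PF; apply: (@prim_comp _ _ _ _ `]-oo, +oo[ _ _ PF).
- by move=> r _; rewrite in_itv.
- by move=> v _; exact: continuous_expR.
Qed.

Lemma prim_inv x y F f : prim x y F f -> (forall r, x <= r <= y -> 0 < F r) ->
  prim x y (fun r => (F r)^-1) (fun r => - (F r) ^- 2 * f r).
Proof.
move=> PF F0.
apply: (@prim_comp _ _ _ _ `]0, +oo[ (fun v => v^-1) (fun v => - v ^- 2) PF).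
- by move=> r /F0; rewrite in_itv /= andbT.
- move=> v; rewrite in_itv /= andbT => v0.
  have := @is_deriveV R id v 1 1 (lt0r_neq0 v0) (is_derive_id v 1).
  by rewrite /GRing.scale /= mulr1.
- move=> v; rewrite in_itv /= andbT => v0.
  have n0 : v ^+ 2 != 0 by rewrite expf_neq0 // lt0r_neq0.
  apply: cvgN; apply: cvgV => //; exact: exprn_continuous.
Qed.

(** The rate [g] may be negative, and then the bound expresses decay. *)
Lemma gronwall x y F f g : x <= y -> prim x y F f -> L1 x y g ->
  (forall r, x <= r <= y -> f r <= g r * F r) -> F y <= F x * expR (int g x y).
Proof.
move=> xy PF gi H.
have PE := prim_exp (prim_opp (prim_int gi)).
have PM := prim_mul PF PE.
have := prim_le xy PM (prim_cst x y 0) => /(_ _).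
rewrite [0 - 0]subr0 subr_le0 int_point oppr0 expR0 mulr1 => K.
have {}K : F y * expR (- int g x y) <= F x.
  apply: K => r rxy; have := H r rxy; have := expR_gt0 (- int g x r).
  set E := expR _ => E0 h; have : 0 <= E * (g r * F r - f r) by rewrite mulr_ge0 ?subr_ge0 // ltW.
  lra.
by move: K; rewrite expRN ler_pdivrMr // expR_gt0.
Qed.

Lemma gronwall_back x y F f g : x <= y -> prim x y F f -> L1 x y g ->
  (forall r, x <= r <= y -> - (g r * F r) <= f r) -> F x <= F y * expR (int g x y).
Proof.
move=> xy PF gi H.
have PE := prim_exp (prim_int gi).
have PM := prim_mul PF PE.
have := prim_le xy (prim_cst x y 0) PM => /(_ _).
rewrite [0 - 0]subr0 subr_ge0 int_point expR0 mulr1; apply => r rxy.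
have := H r rxy; have := expR_gt0 (int g x r).
set E := expR _ => E0 h.
have : 0 <= E * (f r + g r * F r) by rewrite mulr_ge0 ?(ltW E0) //; lra.
lra.
Qed.

End Primitives.

(** * Complex-valued primitives and solutions *)

Section ComplexPrimitives.
Variable R : realType.
Implicit Types (f g F G q : R -> R) (x y s t r : R) (u v p U V : R -> R[i]) (z k : R[i]).

Lemma normc_ge0 z : 0 <= normc z.
Proof. by case: z => a b; exact: sqrtr_ge0. Qed.

Lemma sqr_normcE z : normc z ^+ 2 = complex.Re z ^+ 2 + complex.Im z ^+ 2.
Proof. by case: z => a b; rewrite /= sqr_sqrtr // addr_ge0 ?sqr_ge0. Qed.

Lemma normr_normc z : `|z| = (normc z)%:C.
Proof. by case: z. Qed.

Lemma normc_conj z : normc (z^*) = normc z.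
Proof. by case: z => a b /=; rewrite sqrrN. Qed.

Lemma normc_real x : normc (x%:C) = `|x|.
Proof. by rewrite /= expr0n addr0 sqrtr_sqr. Qed.

Lemma normr_Re_le z : `|complex.Re z| <= normc z.
Proof.
rewrite -[`|_|]ger0_norm // -sqrtr_sqr; case: z => a b /=.
by rewrite real_normK ?num_real // ler_wsqrtr // lerDl sqr_ge0.
Qed.

Lemma normr_Im_le z : `|complex.Im z| <= normc z.
Proof.
rewrite -[`|_|]ger0_norm // -sqrtr_sqr; case: z => a b /=.
by rewrite real_normK ?num_real // ler_wsqrtr // lerDr sqr_ge0.
Qed.

Lemma normc_le_ReIm z : normc z <= `|complex.Re z| + `|complex.Im z|.
Proof.
rewrite -(@ler_pXn2r _ 2) ?nnegrE ?normc_ge0 ?addr_ge0 // sqr_normcE.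
rewrite sqrrD !real_normK ?num_real //.
have : 0 <= `|complex.Re z| * `|complex.Im z| by rewrite mulr_ge0.
rewrite mulr2n; lra.
Qed.

Lemma normc_gt0 z : z != 0 -> 0 < normc z.
Proof.
by move=> z0; rewrite lt_neqAle normc_ge0 andbT eq_sym; apply: contra z0 => /eqP /eq0_normc ->.
Qed.

Lemma ler_normcB z k : normc z - normc k <= normc (z + k).
Proof. by have := le_normcD (z + k) (- k); rewrite addrK normcN; lra. Qed.

Lemma complex_eq z k : complex.Re z = complex.Re k -> complex.Im z = complex.Im k -> z = k.
Proof. by case: z => a b; case: k => c d /= -> ->. Qed.

Lemma realC2 : 2%:C = 2 :> R[i].
Proof. exact: rmorph_nat. Qed.

Lemma ReB z k : complex.Re (z - k) = complex.Re z - complex.Re k.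
Proof. by case: z k => ? ? [? ?]. Qed.

Lemma ImB z k : complex.Im (z - k) = complex.Im z - complex.Im k.
Proof. by case: z k => ? ? [? ?]. Qed.

Definition nsq z : R := complex.Re z ^+ 2 + complex.Im z ^+ 2.

Lemma nsqE z : nsq z = normc z ^+ 2.
Proof. by rewrite sqr_normcE. Qed.

Lemma nsq_ge0 z : 0 <= nsq z.
Proof. by rewrite addr_ge0 ?sqr_ge0. Qed.

Lemma nsq_eq0 z : nsq z = 0 -> z = 0.
Proof. by rewrite nsqE => /eqP; rewrite sqrf_eq0 => /eqP /eq0_normc. Qed.

Lemma normc_mul_le z k : normc z * normc k <= (nsq z + nsq k) / 2.
Proof. by rewrite !nsqE; have := sqr_ge0 (normc z - normc k); rewrite sqrrB; lra. Qed.

Definition cprim x y U V :=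
  prim x y (fun r => complex.Re (U r)) (fun r => complex.Re (V r)) /\
  prim x y (fun r => complex.Im (U r)) (fun r => complex.Im (V r)).

Lemma cprim_ext x y U V U' V' : cprim x y U V ->
  (forall r, x <= r <= y -> U r = U' r) ->
  (forall r, x <= r <= y -> V r = V' r) -> cprim x y U' V'.
Proof.
by move=> [P1 P2] EU EV; split; [apply: prim_ext P1 _ _ | apply: prim_ext P2 _ _] => r rxy;
  rewrite ?EU ?EV.
Qed.

Lemma cprim_sub x y s t U V : cprim x y U V -> x <= s -> t <= y -> cprim s t U V.
Proof. by move=> [P1 P2] xs ty; split; apply: prim_sub; eauto. Qed.

Lemma cprim_add x y U V U' V' : cprim x y U V -> cprim x y U' V' ->
  cprim x y (fun r => U r + U' r) (fun r => V r + V' r).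
Proof.
move=> [P1 P2] [Q1 Q2]; split.
- by apply: prim_ext (prim_add P1 Q1) _ _ => r _; case: (U r) (U' r) (V r) (V' r) => ? ? [? ?] [? ?] [? ?].
- by apply: prim_ext (prim_add P2 Q2) _ _ => r _; case: (U r) (U' r) (V r) (V' r) => ? ? [? ?] [? ?] [? ?].
Qed.

Lemma cprim_cst x y z : cprim x y (fun=> z) (fun=> 0).
Proof. by split; apply: prim_cst. Qed.

Lemma cprim_real x y F f : prim x y F f -> cprim x y (fun r => (F r)%:C) (fun r => (f r)%:C).
Proof. by move=> PF; split => //=; apply: prim_cst. Qed.

Lemma cprim_mul x y U V U' V' : cprim x y U V -> cprim x y U' V' ->
  cprim x y (fun r => U r * U' r) (fun r => V r * U' r + U r * V' r).
Proof.
move=> [P1 P2] [Q1 Q2]; split.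
- apply: prim_ext (prim_subf (prim_mul P1 Q1) (prim_mul P2 Q2)) _ _ => r _;
    case: (U r) (U' r) (V r) (V' r) => ? ? [? ?] [? ?] [? ?] //=; ring.
- apply: prim_ext (prim_add (prim_mul P1 Q2) (prim_mul P2 Q1)) _ _ => r _;
    case: (U r) (U' r) (V r) (V' r) => ? ? [? ?] [? ?] [? ?] //=; ring.
Qed.

Lemma cprim_scale x y z U V : cprim x y U V ->
  cprim x y (fun r => z * U r) (fun r => z * V r).
Proof.
move=> PU; apply: cprim_ext (cprim_mul (cprim_cst x y z) PU) _ _ => // r _.
by rewrite mul0r add0r.
Qed.

Lemma cprim_subf x y U V U' V' : cprim x y U V -> cprim x y U' V' ->
  cprim x y (fun r => U r - U' r) (fun r => V r - V' r).
Proof.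
move=> PU /(cprim_scale (-1)) PU'; apply: cprim_ext (cprim_add PU PU') _ _ => r _;
  by rewrite mulN1r.
Qed.

Lemma cprim_conj x y U V : cprim x y U V -> cprim x y (fun r => (U r)^*) (fun r => (V r)^*).
Proof.
move=> [P1 P2]; split.
- by apply: prim_ext P1 _ _ => r _; case: (U r) (V r) => ? ? [? ?].
- by apply: prim_ext (prim_opp P2) _ _ => r _; case: (U r) (V r) => ? ? [? ?].
Qed.

Lemma cprim_Re x y U V : cprim x y U V ->
  prim x y (fun r => complex.Re (U r)) (fun r => complex.Re (V r)).
Proof. by case. Qed.

Lemma cprim_Im x y U V : cprim x y U V ->
  prim x y (fun r => complex.Im (U r)) (fun r => complex.Im (V r)).
Proof. by case. Qed.

Lemma cprim_nsq x y U V : cprim x y U V ->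
  prim x y (fun r => nsq (U r)) (fun r => 2 * complex.Re ((U r)^* * V r)).
Proof.
move=> [P1 P2]; apply: prim_ext (prim_add (prim_mul P1 P1) (prim_mul P2 P2)) _ _ => r _ //.
by case: (U r) (V r) => ? ? [? ?] /=; ring.
Qed.

(** The factor 2 comes from bounding real and imaginary parts separately; it only affects
    constants. *)
Lemma cprim_bound x y U V f : x <= y -> cprim x y U V -> L1 x y f ->
  (forall r, x <= r <= y -> normc (V r) <= f r) ->
  normc (U y - U x) <= 2 * int f x y.
Proof.
move=> xy [[i1 H1] [i2 H2]] fi H.
apply: le_trans (normc_le_ReIm _) _; rewrite mulr_natl mulr2n.
apply: lerD.
  have -> : complex.Re (U y - U x) = complex.Re (U y) - complex.Re (U x).
    by case: (U y) (U x) => ? ? [? ?].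
  rewrite H1 //; apply: le_trans (int_norm i1) _; apply: int_le => //; first exact: L1_norm.
  by move=> r rxy; apply: le_trans (normr_Re_le _) (H r rxy).
have -> : complex.Im (U y - U x) = complex.Im (U y) - complex.Im (U x).
  by case: (U y) (U x) => ? ? [? ?].
rewrite H2 //; apply: le_trans (int_norm i2) _; apply: int_le => //; first exact: L1_norm.
by move=> r rxy; apply: le_trans (normr_Im_le _) (H r rxy).
Qed.

Definition cexp z : R[i] :=
  (expR (complex.Re z) * cos (complex.Im z)) +i* (expR (complex.Re z) * sin (complex.Im z)).

Lemma normc_cexp z : normc (cexp z) = expR (complex.Re z).
Proof.
rewrite /= !exprMn -mulrDr cos2Dsin2 mulr1 sqrtr_sqr ger0_norm // expR_ge0.
Qed.

Lemma cprim_cexp x y k : cprim x y (fun r => cexp (k * r%:C)) (fun r => k * cexp (k * r%:C)).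
Proof.
have Pid := prim_id x y.
case: k => a b.
have Pe := prim_exp (prim_scale a Pid).
have Pb := prim_scale b Pid.
have Pc := @prim_comp R x y _ _ `]-oo, +oo[ cos (fun v : R => - sin v) Pb.
have {}Pc : prim x y (fun r => cos (b * r)) (fun r => - sin (b * r) * (b * 1)).
  apply: Pc => v _; first by rewrite in_itv.
  by apply: cvgN; exact: continuous_sin.
have Ps := @prim_comp R x y _ _ `]-oo, +oo[ sin cos Pb.
have {}Ps : prim x y (fun r => sin (b * r)) (fun r => cos (b * r) * (b * 1)).
  apply: Ps => v _; first by rewrite in_itv.
  exact: continuous_cos.
split.
- apply: prim_ext (prim_mul Pe Pc) _ _ => r _ /=; rewrite !mulr0 !subr0 ?add0r //=; ring.
- apply: prim_ext (prim_mul Pe Ps) _ _ => r _ /=; rewrite !mulr0 !subr0 ?add0r //=; ring.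
Qed.

(** The first-order system [u' = p], [p' = (q - z) u]. Carrying [p] along makes the notion stable
    under restriction, combination and conjugation without any differentiation. *)
Definition sol x y q z u p := [/\ L1 x y q, cprim x y u p
  & cprim x y p (fun r => ((q r)%:C - z) * u r)].

Lemma sol_sub x y s t q z u p : sol x y q z u p -> x <= s -> t <= y -> sol s t q z u p.
Proof.
by move=> [qi Pu Pp] xs ty; split; [apply: L1_sub qi _ _ | apply: cprim_sub Pu _ _ | apply: cprim_sub Pp _ _].
Qed.

Lemma sol_lin x y q z u p u' p' k : sol x y q z u p -> sol x y q z u' p' ->
  sol x y q z (fun r => u r + k * u' r) (fun r => p r + k * p' r).
Proof.
move=> [qi Pu Pp] [_ Pu' Pp']; split => //.
  exact: cprim_add Pu (cprim_scale k Pu').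
by apply: cprim_ext (cprim_add Pp (cprim_scale k Pp')) _ _ => // r _; ring.
Qed.

Lemma lagrange x y q z u p : sol x y q z u p ->
  prim x y (fun r => complex.Im ((u r)^* * p r)) (fun r => - complex.Im z * nsq (u r)).
Proof.
move=> [qi Pu Pp].
apply: prim_ext (cprim_Im (cprim_mul (cprim_conj Pu) Pp)) _ _ => // r _; rewrite /nsq; clear qi Pu Pp.
by case: (u r) (p r) z => ? ? [? ?] [? ?] /=; ring.
Qed.

Lemma wronskian_prim x y q1 q2 z1 z2 u1 p1 u2 p2 :
  sol x y q1 z1 u1 p1 -> sol x y q2 z2 u2 p2 ->
  cprim x y (fun r => u1 r * p2 r - p1 r * u2 r)
            (fun r => ((q2 r - q1 r)%:C - (z2 - z1)) * (u1 r * u2 r)).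
Proof.
move=> [_ Pu Pp] [_ Pu' Pp'].
apply: cprim_ext (cprim_subf (cprim_mul Pu Pp') (cprim_mul Pp Pu')) _ _ => // r _.
by rewrite rmorphB /=; ring.
Qed.

Lemma energy_prim x y q z u p : sol x y q z u p ->
  prim x y (fun r => nsq (u r) + nsq (p r))
    (fun r => 2 * complex.Re ((u r)^* * p r) +
              2 * complex.Re ((p r)^* * (((q r)%:C - z) * u r))).
Proof. by move=> [_ Pu Pp]; exact: prim_add (cprim_nsq Pu) (cprim_nsq Pp). Qed.

Lemma energy_rate (a : R) z (c d : R[i]) :
  `|2 * complex.Re (c^* * d) + 2 * complex.Re (d^* * ((a%:C - z) * c))| <=
  (1 + normc z + `|a|) * (nsq c + nsq d).
Proof.
have k1 : `|complex.Re (c^* * d)| <= (nsq c + nsq d) / 2.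
  by apply: le_trans (normr_Re_le _) _; rewrite normcM normc_conj; exact: normc_mul_le.
have k2 : `|complex.Re (d^* * ((a%:C - z) * c))| <= (normc z + `|a|) * ((nsq c + nsq d) / 2).
  apply: le_trans (normr_Re_le _) _; rewrite !normcM normc_conj mulrCA.
  apply: ler_pM; rewrite ?normc_ge0 ?mulr_ge0 ?normc_ge0 //.
    by apply: le_trans (le_normcD _ _) _; rewrite normc_real normcN addrC.
  by rewrite mulrC; exact: normc_mul_le.
apply: le_trans (ler_normD _ _) _; rewrite !normrM [`|2|]ger0_norm //.
move: k1 k2; set A := `|_|; set B := `|_|; set n := nsq c + nsq d; lra.
Qed.

Definition rate z q : R -> R := fun r => 1 + normc z + `|q r|.

Lemma rate_L1 x y z q : L1 x y q -> L1 x y (rate z q).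
Proof.
move=> qi; apply: L1_add; last exact: L1_norm.
by apply: cont_L1; apply: continuous_subspaceT => ?; exact: cvg_cst.
Qed.

Lemma energy_fwd x y q z u p : x <= y -> sol x y q z u p ->
  nsq (u y) + nsq (p y) <= (nsq (u x) + nsq (p x)) * expR (int (rate z q) x y).
Proof.
move=> xy S; have [qi _ _] := S.
apply: (gronwall xy (energy_prim S) (rate_L1 z qi)) => r _.
exact: le_trans (ler_norm _) (energy_rate _ _ _ _).
Qed.

Lemma energy_bwd x y q z u p : x <= y -> sol x y q z u p ->
  nsq (u x) + nsq (p x) <= (nsq (u y) + nsq (p y)) * expR (int (rate z q) x y).
Proof.
move=> xy S; have [qi _ _] := S.
apply: (gronwall_back xy (energy_prim S) (rate_L1 z qi)) => r _.
rewrite lerNl; have := energy_rate (q r) z (u r) (p r); rewrite ler_norml => /andP[h _].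
by rewrite lerNl.
Qed.

End ComplexPrimitives.

(** * Decay estimates under nonnegative flux *)

Section Decay.
Variable R : realType.
Implicit Types (f g F G q : R -> R) (x y s t r : R) (u v p U V : R -> R[i]) (z k c d : R[i]).

(** Multiply [k * c - d] by the conjugate of [c]: minus the imaginary part of the product is
    [- Im k |c|^2] plus the flux of [c, d], two nonnegative terms. *)
Lemma weyl_lower (sigma : R) k c d : 0 < sigma -> sigma * normc k <= - complex.Im k ->
  0 <= complex.Im (c^* * d) -> sigma * normc k * normc c <= normc (k * c - d).
Proof.
move=> s0 hk hd; have [->|c0] := eqVneq c 0; first by rewrite normc0 mulr0 normc_ge0.
have nc := normc_gt0 c0.
rewrite -(ler_pM2r nc).
have -> : sigma * normc k * normc c * normc c = sigma * normc k * normc c ^+ 2 by ring.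
have -> : normc (k * c - d) * normc c = normc (c^* * (k * c - d)).
  by rewrite normcM normc_conj mulrC.
apply: (@le_trans _ _ (- complex.Im (c^* * (k * c - d)))); last first.
  by apply: le_trans (normr_Im_le _); rewrite -normrN; exact: ler_norm.
have -> : - complex.Im (c^* * (k * c - d)) = - complex.Im k * normc c ^+ 2 + complex.Im (c^* * d).
  rewrite sqr_normcE; case: (c) (d) (k) => ? ? [? ?] [? ?] /=; ring.
rewrite -[X in X <= _]addr0 lerD //; apply: ler_wpM2r => //; exact: sqr_ge0.
Qed.

Lemma weyl_ratio (sigma : R) k c d : 0 < sigma -> 0 < normc k -> sigma * normc k <= - complex.Im k ->
  0 <= complex.Im (c^* * d) -> normc (k * c + d) <= (1 + 2 / sigma) * normc (k * c - d).
Proof.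
move=> s0 k0 hk hd; have h := weyl_lower s0 hk hd.
have -> : k * c + d = - (k * c - d) + 2%:C * (k * c).
  by rewrite realC2; ring.
apply: le_trans (le_normcD _ _) _; rewrite normcN mulrDl mul1r lerD2l.
rewrite !normcM normc_real ger0_norm // -mulrA ler_pM2l //.
by rewrite ler_pdivlMl // mulrA.
Qed.

Section Interval.
Variables (x y : R) (q : R -> R) (u p : R -> R[i]) (k : R[i]) (sigma : R).
Hypothesis xy : x <= y.
Hypothesis S : sol x y q (- k ^+ 2) u p.
Hypothesis pos : forall r, x <= r <= y -> 0 <= complex.Im ((u r)^* * p r).
Hypotheses (sigma0 : 0 < sigma) (k0 : 0 < normc k) (Imk : sigma * normc k <= - complex.Im k).

Let A r := k * u r - p r.
Let B r := k * u r + p r.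

Let PA : cprim x y A (fun r => - k * A r - (q r)%:C * u r).
Proof.
have [_ Pu Pp] := S.
by apply: cprim_ext (cprim_subf (cprim_scale k Pu) Pp) _ _ => // r _; rewrite /A; ring.
Qed.

Let PB : cprim x y B (fun r => k * B r + (q r)%:C * u r).
Proof.
have [_ Pu Pp] := S.
by apply: cprim_ext (cprim_add (cprim_scale k Pu) Pp) _ _ => // r _; rewrite /B; ring.
Qed.

Let uA r : x <= r <= y -> normc (u r) <= normc (A r) / (sigma * normc k).
Proof.
move=> rxy; rewrite ler_pdivlMr ?mulr_gt0 // mulrC.
exact: weyl_lower (pos rxy).
Qed.

Lemma decay : normc (k * u y - p y) <=
  normc (k * u x - p x) *
  expR (- (y - x) * complex.Re k + int (fun r => `|q r|) x y / (sigma * normc k)).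
Proof.
have [qi _ _] := S; have sk : 0 < sigma * normc k by rewrite mulr_gt0.
set I := int _ x y.
(* Gronwall is applied to |A|^2. The term [q u] in A' is absorbed into the rate through [uA], which
   bounds |u| by |A| / (sigma |k|). *)
pose g r := - 2 * complex.Re k + 2 / (sigma * normc k) * `|q r|.
have ci : L1 x y (fun=> - 2 * complex.Re k).
  by apply: cont_L1; apply: continuous_subspaceT => ?; exact: cvg_cst.
have qi2 : L1 x y (fun r => 2 / (sigma * normc k) * `|q r|) by apply: L1_scale; exact: L1_norm.
have gi : L1 x y g by exact: L1_add.
have intg : int g x y = (- (y - x) * complex.Re k + I / (sigma * normc k)) * 2.
  rewrite int_add // int_cst // int_scale; last exact: L1_norm.
  by rewrite -/I; field; rewrite !lt0r_neq0.
have := gronwall xy (cprim_nsq PA) gi; rewrite intg expRM_natr !nsqE -exprMn => H.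
rewrite -(@ler_pXn2r _ 2) ?nnegrE ?mulr_ge0 ?normc_ge0 ?expR_ge0 //.
apply: H => r rxy.
have -> : complex.Re ((A r)^* * (- k * A r - (q r)%:C * u r)) =
  - complex.Re k * normc (A r) ^+ 2 - q r * complex.Re ((A r)^* * u r).
  rewrite sqr_normcE; case: (A r) (u r) (k) (q r) => ? ? [? ?] [? ?] ? /=; ring.
have h : - (q r * complex.Re ((A r)^* * u r)) <= `|q r| * (normc (A r) ^+ 2 / (sigma * normc k)).
  rewrite (le_trans (ler_norm _)) // normrN normrM ler_wpM2l //.
  rewrite (le_trans (normr_Re_le _)) // normcM normc_conj expr2 -mulrA.
  by rewrite ler_wpM2l ?normc_ge0 //; exact: uA.
rewrite /g nsqE; move: h; set w := q r * _; set m := normc (A r) ^+ 2.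
have -> : (-2 * complex.Re k + 2 / (sigma * normc k) * `|q r|) * m =
  - 2 * (complex.Re k * m) + 2 * (`|q r| * (m / (sigma * normc k))) by ring.
lra.
Qed.

End Interval.

(** The product [B exp(- k r)] has derivative [q u exp(- k r)], so B at [x] is recovered from B at
    [y], where the flux gives |B| <= (1 + 2 / sigma) |A|. Going back costs [exp(- (y - x) Re k)],
    and the decay of A up to [y] contributes the same factor once more. *)
Lemma ratio_bound x y q u p k (sigma : R) : x <= y -> sol x y q (- k ^+ 2) u p ->
  (forall r, x <= r <= y -> 0 <= complex.Im ((u r)^* * p r)) ->
  0 < sigma -> 0 < normc k -> sigma * normc k <= - complex.Im k -> 0 <= complex.Re k -> forall I, I = int (fun r => `|q r|) x y ->
  normc (k * u x + p x) <= normc (k * u x - p x) * expR (I / (sigma * normc k)) *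
    ((1 + 2 / sigma) * expR (- (2 * (y - x)) * complex.Re k) + 2 * I / (sigma * normc k)).
Proof.
move=> xy S pos s0 k0 Imk Rek I EI.
have [qi Pu Pp] := S.
have sk : 0 < sigma * normc k by rewrite mulr_gt0.
set G := expR _; set a := normc (k * u x - p x).
pose B r := k * u r + p r.
have PB : cprim x y B (fun r => k * B r + (q r)%:C * u r).
  by apply: cprim_ext (cprim_add (cprim_scale k Pu) Pp) _ _ => // r _; rewrite /B; ring.
have PU := cprim_mul PB (cprim_cexp x y (- k)).
have {}PU : cprim x y (fun r => B r * cexp (- k * r%:C))
    (fun r => (q r)%:C * u r * cexp (- k * r%:C)).
  by apply: cprim_ext PU _ _ => // r _; ring.
have Ek r : normc (cexp (- k * r%:C)) = expR (- r * complex.Re k).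
  by rewrite normc_cexp; congr expR; case: (k) => ? ? /=; ring.
have dec r : x <= r <= y -> normc (k * u r - p r) <= a * G * expR (- (r - x) * complex.Re k).
  move=> /andP[xr ry].
  have := decay xr (sol_sub S (lexx x) ry) _ s0 k0 Imk.
  move=> H; apply: le_trans (H _) _.
    by move=> t /andP[? tr]; apply: pos; rewrite (le_trans tr) ?andbT.
  rewrite -/a -mulrA ler_wpM2l ?normc_ge0 // expRD mulrC ler_wpM2r ?expR_ge0 //.
  rewrite ler_expR ler_pM2r ?invr_gt0 // EI; apply: int_subset => //; exact: L1_norm.
have inv0 : 0 <= (sigma * normc k)^-1 by rewrite invr_ge0 ltW.
have a0 : 0 <= a by exact: normc_ge0.
have G0 : 0 <= G by exact: expR_ge0.
have bnd := cprim_bound xy PU (L1_scale (a * G / (sigma * normc k) * expR (- x * complex.Re k)) (L1_norm qi)).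
have {}bnd : normc (B y * cexp (- k * y%:C) - B x * cexp (- k * x%:C)) <=
    2 * (a * G / (sigma * normc k) * expR (- x * complex.Re k) * I).
  rewrite EI -int_scale; last exact: L1_norm.
  apply: bnd => r rxy; rewrite !normcM normc_real Ek mulrC -!mulrA mulrCA [leRHS]mulrA [leRHS]mulrA [leRHS]mulrA [leRHS]mulrC.
  apply: ler_wpM2l => //.
  have h1 : normc (u r) <= normc (k * u r - p r) / (sigma * normc k).
    by rewrite ler_pdivlMr // mulrC; exact: weyl_lower (pos _ rxy).
  apply: (@le_trans _ _ (expR (- r * complex.Re k) * (a * G * expR (- (r - x) * complex.Re k) / (sigma * normc k)))).
    rewrite ler_wpM2l ?expR_ge0 // (le_trans h1) // ler_wpM2r //; exact: dec.
  rewrite [leLHS](_ : _ = a * G / (sigma * normc k) * (expR (- r * complex.Re k) * expR (- (r - x) * complex.Re k))); last by ring.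
  rewrite -expRD; apply: ler_wpM2l; first by rewrite !mulr_ge0.
  rewrite ler_expR -mulrDl ler_wpM2r //; have /andP[xr _] := rxy; lra.
have yy : x <= y <= y by rewrite xy lexx.
have By : normc (B y * cexp (- k * y%:C)) <=
    (1 + 2 / sigma) * (a * G * expR (- (2 * (y - x)) * complex.Re k)) * expR (- x * complex.Re k).
  rewrite normcM Ek.
  apply: (@le_trans _ _ ((1 + 2 / sigma) * (a * G * expR (- (y - x) * complex.Re k)) * expR (- y * complex.Re k))).
    rewrite ler_wpM2r ?expR_ge0 //.
    apply: le_trans (weyl_ratio s0 k0 Imk (pos _ yy)) _.
    rewrite ler_wpM2l ?dec // addr_ge0 // divr_ge0 // ltW //.
  rewrite -!mulrA.
  by rewrite le_eqVlt; apply/orP; left; apply/eqP; do 3 congr (_ * _); rewrite -!expRD; congr expR; ring.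
have := ler_normcB (B x * cexp (- k * x%:C)) (B y * cexp (- k * y%:C) - B x * cexp (- k * x%:C)).
rewrite [_ + (_ - _)]addrC subrK normcM Ek => tri.
have E0 := expR_gt0 (- x * complex.Re k).
rewrite -(ler_pM2r E0).
rewrite [X in _ <= X](_ : _ = (1 + 2 / sigma) * (a * G * expR (- (2 * (y - x)) * complex.Re k)) * expR (- x * complex.Re k) + 2 * (a * G / (sigma * normc k) * expR (- x * complex.Re k) * I)); last by field; rewrite !lt0r_neq0.
rewrite -/(B x).
lra.
Qed.

Lemma expRN_mul_le1 (t : R) : expR (- t) * t <= 1.
Proof.
rewrite expRN mulrC ler_pdivrMr ?expR_gt0 // mul1r.
have := expR_ge1Dx t; lra.
Qed.

(** The constant in |B| |k| <= Omega |A|. The factor [expR 1] bounds the Gronwall loss when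
    [s <= sigma |k|]. Over half a window the boundary term carries [exp(- delta Re k)], and
    [exp(- t) t <= 1] with [Re k >= sigma |k|] converts it into [1 / (delta sigma |k|)]. The last
    summand is the integral term. *)
Definition Omega (delta sigma s : R) : R :=
  expR 1 * ((1 + 2 / sigma) / (delta * sigma) + 2 * s / sigma).

Lemma ratio_decay x (delta s : R) q u p k (sigma : R) : 0 < delta ->
  sol x (x + delta / 2) q (- k ^+ 2) u p ->
  (forall r, x <= r <= x + delta / 2 -> 0 <= complex.Im ((u r)^* * p r)) ->
  0 < sigma -> 0 < normc k -> sigma * normc k <= - complex.Im k ->
  sigma * normc k <= complex.Re k ->
  int (fun r => `|q r|) x (x + delta / 2) <= s -> s <= sigma * normc k ->
  normc (k * u x + p x) * normc k <= Omega delta sigma s * normc (k * u x - p x).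
Proof.
move=> d0 S pos s0 k0 Imk Rek Is sk.
have sk0 : 0 < sigma * normc k by rewrite mulr_gt0.
have Rek0 : 0 <= complex.Re k by rewrite (le_trans _ Rek) // ltW.
have xy : x <= x + delta / 2 by rewrite lerDl divr_ge0 // ltW.
have I0 : 0 <= int (fun r => `|q r|) x (x + delta / 2) by exact: int_ge0.
have := ratio_bound xy S pos s0 k0 Imk Rek0 erefl; move: Is I0.
set I := int _ _ _; set a := normc (k * u x - p x) => Is I0 H.
have a0 : 0 <= a by exact: normc_ge0.
have w0 : 0 <= 1 + 2 / sigma by rewrite addr_ge0 // divr_ge0 // ltW.
have h1 : expR (I / (sigma * normc k)) <= expR 1.
  by rewrite ler_expR ler_pdivrMr // mul1r (le_trans Is).
have h2 : expR (- (2 * (x + delta / 2 - x)) * complex.Re k) * normc k <= (delta * sigma)^-1.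
  have -> : - (2 * (x + delta / 2 - x)) * complex.Re k = - (delta * complex.Re k) by field.
  rewrite -[leRHS]mul1r ler_pdivlMr ?mulr_gt0 //.
  apply: le_trans (expRN_mul_le1 (delta * complex.Re k)).
  rewrite -mulrA ler_wpM2l ?expR_ge0 //.
  by rewrite mulrC -mulrA ler_wpM2l // ltW.
have k1 := ltW k0.
apply: (@le_trans _ _ (a * expR (I / (sigma * normc k)) *
  ((1 + 2 / sigma) * expR (- (2 * (x + delta / 2 - x)) * complex.Re k) +
         2 * I / (sigma * normc k)) * normc k)); first by apply: ler_wpM2r.
rewrite [leRHS]mulrC /Omega -!mulrA ler_wpM2l // ler_pM ?expR_ge0 //.
  rewrite mulr_ge0 // addr_ge0 // ?mulr_ge0 ?expR_ge0 ?invr_ge0 ?mulr_ge0 // ltW //.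
rewrite mulrDl -mulrA lerD // ?ler_wpM2l //.
rewrite [leLHS](_ : _ = 2 * (I / sigma)); last by field; rewrite !lt0r_neq0.
by rewrite !ler_wpM2l // ler_wpM2r // invr_ge0 ltW.
Qed.

Lemma aeS (P Q : R -> Prop) : (forall r, P r -> Q r) ->
  {ae (@lebesgue_measure R), forall r, P r} -> {ae (@lebesgue_measure R), forall r, Q r}.
Proof. by move=> PQ; apply: (@filterS _ _ (ae_filter_ringOfSetsType _)). Qed.

Lemma int_ae0 x y f : L1 x y f ->
  {ae (@lebesgue_measure R), forall r, x <= r <= y -> f r = 0} -> int f x y = 0.
Proof.
move=> fi ae0; rewrite /int /Rintegral.
suff -> : (\int[lebesgue_measure]_(r in `[x, y]) (f r)%:E = \int[(@lebesgue_measure R)]_(r in `[x, y]) 0)%E.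
  by rewrite integral0.
apply: ae_eq_integral => //.
- by have /integrableP[] := fi.
- by apply: (aeS _ ae0) => r H /=; rewrite in_itv /= => /H ->.
Qed.

Lemma wronskian_const x y q1 q2 z u1 p1 u2 p2 : x <= y ->
  sol x y q1 z u1 p1 -> sol x y q2 z u2 p2 ->
  {ae (@lebesgue_measure R), forall r, x <= r <= y -> q1 r = q2 r} ->
  u1 y * p2 y - p1 y * u2 y = u1 x * p2 x - p1 x * u2 x.
Proof.
move=> xy S1 S2 ae; have [P1 P2] := wronskian_prim S1 S2.
have [i1 H1] := P1; have [i2 H2] := P2.
apply/eqP; rewrite -subr_eq0; apply/eqP; apply: complex_eq.
- have := H1 x y (lexx _) xy (lexx _); rewrite int_ae0 //.
    by move=> E; rewrite ReB E.
  by apply: (aeS _ ae) => r H /H ->; rewrite !subrr mul0r.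
- have := H2 x y (lexx _) xy (lexx _); rewrite int_ae0 //.
    by move=> E; rewrite ImB E.
  by apply: (aeS _ ae) => r H /H ->; rewrite !subrr mul0r.
Qed.

(* With [A = k u - p] and [B = k u + p], both Weyl solutions have [B] small against [A],
   and the Wronskian, which is constant, equals [(A1 B2 - B1 A2) / (2 k)] at [y]. *)
Lemma wronskian_decay x y k u1 p1 u2 p2 (Om1 Om2 : R) : 0 < normc k ->
  u1 y * p2 y - p1 y * u2 y = u1 x * p2 x - p1 x * u2 x ->
  normc (k * u1 y + p1 y) * normc k <= Om1 * normc (k * u1 y - p1 y) ->
  normc (k * u2 y + p2 y) * normc k <= Om2 * normc (k * u2 y - p2 y) ->
  normc (k * u1 x + p1 x) * normc k <= Om1 * normc (k * u1 x - p1 x) ->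
  normc (k * u2 x + p2 x) * normc k <= Om2 * normc (k * u2 x - p2 x) ->
  0 <= Om1 -> 0 <= Om2 ->
  2 * Om1 <= normc k -> 2 * Om2 <= normc k ->
  normc (k * u1 y - p1 y) <= normc (k * u1 x - p1 x) * expR (- (y - x) * complex.Re k + 1) ->
  normc (k * u2 y - p2 y) <= normc (k * u2 x - p2 x) * expR (- (y - x) * complex.Re k + 1) ->
  normc (u1 x * p2 x - p1 x * u2 x) <= 8 * (Om1 + Om2) * expR 2 *
    expR (- (2 * (y - x)) * complex.Re k) * (normc (u1 x) * normc (u2 x)).
Proof.
move=> k0 W B1y B2y B1x B2x O1 O2 Ok1 Ok2 dec1 dec2.
move: dec2 dec1; rewrite -W.
have ux (u p : R -> R[i]) (Om : R) : normc (k * u x + p x) * normc k <= Om * normc (k * u x - p x) ->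
    2 * Om <= normc k -> normc (k * u x - p x) <= 4 * normc k * normc (u x).
  move=> h1 h2.
  (* Here B is at most half of A, while A + B = 2 k u; this bounds A at [x] by 4 |k| |u x| and
     prepares the division by the values at 0. *)
  have h3 : 2 * normc (k * u x + p x) <= normc (k * u x - p x).
    rewrite -(ler_pM2r k0) -mulrA; apply: (@le_trans _ _ (2 * (Om * normc (k * u x - p x)))).
      by rewrite ler_wpM2l.
    by rewrite mulrA mulrC ler_wpM2l ?normc_ge0.
  have := ler_normcB (k * u x - p x) (k * u x + p x).
  have -> : k * u x - p x + (k * u x + p x) = 2%:C * (k * u x).
    by rewrite realC2; ring.
  rewrite !normcM normc_real ger0_norm //; lra.
have := ux u1 p1 _ B1x Ok1; have := ux u2 p2 _ B2x Ok2.
have : normc (2%:C * k * (u1 y * p2 y - p1 y * u2 y)) <=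
    normc (k * u1 y - p1 y) * normc (k * u2 y + p2 y) + normc (k * u1 y + p1 y) * normc (k * u2 y - p2 y).
  rewrite -!normcM -[X in _ <= _ + X]normcN.
  apply: le_trans (le_normcD _ _).
  rewrite realC2.
  by rewrite le_eqVlt; apply/orP; left; apply/eqP; congr normc; ring.
rewrite !normcM normc_real [`|2|]ger0_norm //.
move: B1y B2y.
have := normc_ge0 (k * u1 y - p1 y); have := normc_ge0 (k * u2 y - p2 y).
have := normc_ge0 (k * u1 x - p1 x); have := normc_ge0 (k * u2 x - p2 x).
move: (normc (k * u1 y - p1 y)) (normc (k * u2 y - p2 y)) (normc (k * u1 x - p1 x)) (normc (k * u2 x - p2 x))
 (normc (k * u1 y + p1 y)) (normc (k * u2 y + p2 y)) (normc_ge0 (u1 x)) (normc_ge0 (u2 x)).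
move: (normc (u1 x)) (normc (u2 x)) (normc (u1 y * p2 y - p1 y * u2 y)) => v1 v2 w.
move: (normc k) k0 O1 O2 => n k0 O1 O2 a1 a2 A1 A2 b1 b2 v10 v20 A20 A10 a20 a10 B1 B2 HW h2 h1 d2 d1.
rewrite [expR (- (2 * (y - x)) * complex.Re k)](_ : _ = expR (- (y - x) * complex.Re k) ^+ 2); last first.
  by rewrite -expRM_natr; congr expR; rewrite mulr2n; ring.
rewrite [expR 2](_ : _ = expR 1 ^+ 2); last by rewrite -expRM_natr mul1r.
move: d1 d2; rewrite expRD; move: (expR _) (expR 1) (expR_ge0 (- (y - x) * complex.Re k)) (expR_ge0 (1 : R)) => E e E0 e0 d1 d2.
have n0 := ltW k0.
have k1 : a1 * (b2 * n) <= a1 * (Om2 * a2) by exact: ler_wpM2l.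
have k2 : (b1 * n) * a2 <= (Om1 * a1) * a2 by exact: ler_wpM2r.
(* The two factors 4 |k| |u x| against 2 |k|^2 leave the constant 8, with no power of |k|; the two
   losses [expR 1] give [expR 2]. *)
have k3 : 2 * n ^+ 2 * w <= (Om1 + Om2) * (a1 * a2).
  have := ler_wpM2r n0 HW; lra.
have k4 : a1 * a2 <= A1 * (E * e) * (A2 * (E * e)) by apply: ler_pM.
have k5 : A1 * A2 <= (4 * n * v1) * (4 * n * v2) by apply: ler_pM.
have k6 : (Om1 + Om2) * (a1 * a2) <= (Om1 + Om2) * (A1 * (E * e) * (A2 * (E * e))).
  by apply: ler_wpM2l => //; exact: addr_ge0.
have k7 : (Om1 + Om2) * ((E * e) ^+ 2) * (A1 * A2) <= (Om1 + Om2) * ((E * e) ^+ 2) * ((4 * n * v1) * (4 * n * v2)).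
  by apply: ler_wpM2l => //; rewrite mulr_ge0 ?addr_ge0 ?sqr_ge0.
have nn : 0 < 2 * n ^+ 2 by rewrite mulr_gt0 // exprn_gt0.
rewrite -(ler_pM2l nn); lra.
Qed.

End Decay.

(** * Solutions on the whole interval; reduction of order *)

Section Weyl.
Variable R : realType.
Implicit Types (f g F G q : R -> R) (x y s t r : R) (u v w p U V : R -> R[i]) (z : R[i]).
Implicit Types (b : \bar R).

Lemma within_interior x y F r : {within `[x, y], continuous F} -> x < r -> r < y ->
  {for r, continuous F}.
Proof.
move=> cF xr ry; rewrite /prop_for /continuous_at; apply/cvgrPdist_lt => e e0.
have rxy : x <= r <= y by rewrite !ltW.
have [d d0 Hd] := within_ball cF rxy e0.
exists (Num.min d (Num.min (r - x) (y - r))) => /=.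
  by rewrite !lt_min d0 !subr_gt0 xr ry.
move=> t /=; rewrite !lt_min => /and3P[h1 h2 h3].
have := le_lt_trans (ler_norm _) h2; rewrite distrC in h3; have := le_lt_trans (ler_norm _) h3.
move=> h4 h5; rewrite distrC; apply: Hd; last by rewrite distrC.
by apply/andP; split; lra.
Qed.

Lemma prim_cst_eq0 x y F f k r : prim x y F f -> (forall t, x < t < y -> F t = k) ->
  x < r -> r < y -> {for r, continuous f} -> f r = 0.
Proof.
move=> PF Fk xr ry cf.
have D1 := prim_is_derive PF xr ry cf.
have D2 : is_derive r 1 F 0.
  have nE : {near r, (fun=> k) =1 F}.
    have : \forall t \near r, t \in `]x, y[ by apply: near_in_itvoo; rewrite in_itv /= xr.
    by apply: filterS => t; rewrite in_itv /= => /Fk ->.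
  by apply: near_eq_is_derive (is_derive_cst k r (1 : R)) => //; exact: oner_neq0.
by rewrite -(@derive_val _ _ _ _ _ _ _ D1) (@derive_val _ _ _ _ _ _ _ D2).
Qed.

Lemma lte_right y b : (y%:E < b)%E -> exists2 y', y < y' & (y'%:E < b)%E.
Proof.
case: b => [b| |] //.
- rewrite lte_fin => yb; exists ((y + b) / 2); rewrite ?lte_fin; lra.
- by move=> _; exists (y + 1); rewrite ?ltry //; lra.
Qed.

Lemma lte_le_trans_fin x y b : x <= y -> (y%:E < b)%E -> (x%:E < b)%E.
Proof. by move=> xy; apply: le_lt_trans; rewrite lee_fin. Qed.

Lemma conj_coef (a : R) z (c : R[i]) : ((a%:C - z) * c)^* = (a%:C - z^*) * c^*.
Proof. case: c z => ? ? [? ?]; apply: complex_eq => /=; ring. Qed.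

Definition locL1 b q := forall x y, 0 < x -> (y%:E < b)%E -> L1 x y q.

Definition solves b q z u p := forall x y, 0 < x -> x <= y -> (y%:E < b)%E -> sol x y q z u p.

Lemma solves_locL1 b q z u p : solves b q z u p -> locL1 b q.
Proof.
move=> S x y x0 yb; have [xy|yx] := leP x y; first by have [] := S x y x0 xy yb.
rewrite /L1 set_itv_ge ?bnd_simp -?ltNge //; exact: integrable_set0.
Qed.

Lemma solution_solves b q z u : locL1 b q -> solution q b z u -> solves b q z u (cderive u).
Proof.
move=> qi [du pu] x y x0 xy yb.
have cu s t : 0 < s -> (t%:E < b)%E ->
    {within `[s, t], continuous (fun r => complex.Re (u r))} /\
    {within `[s, t], continuous (fun r => complex.Im (u r))}.
  move=> s0 tb; split; apply: derivable_within_continuous => r /[1!in_itv] /= /andP[sr rt].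
  - exact: (du r (lt_le_trans s0 sr) (lte_le_trans_fin rt tb)).1.
  - exact: (du r (lt_le_trans s0 sr) (lte_le_trans_fin rt tb)).2.
have Pp s t : 0 < s -> (t%:E < b)%E -> cprim s t (cderive u) (fun r => ((q r)%:C - z) * u r).
  move=> s0 tb; have [c1 c2] := cu _ _ s0 tb; have qst := qi _ _ s0 tb.
  have i1 : L1 s t (fun r => complex.Re (((q r)%:C - z) * u r)).
    have k1 := L1_mul qst c1; have k2 := cont_L1 c1; have k3 := cont_L1 c2.
    apply: L1_ext (L1_add (L1_sub_fun k1 (L1_scale (complex.Re z) k2)) (L1_scale (complex.Im z) k3)) => r _.
    by clear; case: (u r) z => ? ? [? ?] /=; ring.
  have i2 : L1 s t (fun r => complex.Im (((q r)%:C - z) * u r)).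
    have k1 := L1_mul qst c2; have k2 := cont_L1 c1; have k3 := cont_L1 c2.
    apply: L1_ext (L1_sub_fun (L1_sub_fun k1 (L1_scale (complex.Re z) k3)) (L1_scale (complex.Im z) k2)) => r _.
    by clear; case: (u r) z => ? ? [? ?] /=; ring.
  split; split=> // a c sa ac ct.
  - have /(congr1 (@complex.Re R)) := pu a c (lt_le_trans s0 sa) ac (lte_le_trans_fin ct tb).
    by rewrite ReB.
  - have /(congr1 (@complex.Im R)) := pu a c (lt_le_trans s0 sa) ac (lte_le_trans_fin ct tb).
    by rewrite ImB.
split; [exact: qi| |exact: Pp].
(* The interval is enlarged on both sides, so that the derivative of [u] is known to be continuous
   at the end points [x] and [y] as well. *)
have [y' yy' y'b] := lte_right yb.
have x2 : 0 < x / 2 by lra.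
have [P1 P2] := Pp _ _ x2 y'b.
have c1 := prim_continuous P1; have c2 := prim_continuous P2.
split; apply: prim_derive => r /andP[xr ry].
- have [h _] := du r (lt_le_trans x0 xr) (lte_le_trans_fin ry yb).
  by apply: (DeriveDef h); rewrite /= derive1E.
- by apply: within_interior c1 _ _; lra.
- have [_ h] := du r (lt_le_trans x0 xr) (lte_le_trans_fin ry yb).
  by apply: (DeriveDef h); rewrite /= derive1E.
- by apply: within_interior c2 _ _; lra.
Qed.

(** * Energy and flux of a single solution *)

Section EverySolution.
Variables (b : \bar R) (q : R -> R) (z : R[i]) (u p : R -> R[i]).
Hypothesis S : solves b q z u p.

Lemma solves_continuous r : 0 < r -> (r%:E < b)%E ->
  [/\ {for r, continuous (fun t => complex.Re (u t))}, {for r, continuous (fun t => complex.Im (u t))},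
      {for r, continuous (fun t => complex.Re (p t))} & {for r, continuous (fun t => complex.Im (p t))}].
Proof.
move=> r0 rb; have [y ry yb] := lte_right rb; have r2 : 0 < r / 2 by lra.
have le : r / 2 <= y by lra.
have [_ [P1 P2] [Q1 Q2]] := S r2 le yb.
by split; [move: P1 | move: P2 | move: Q1 | move: Q2] => /prim_continuous /within_interior; apply => //; lra.
Qed.

Lemma solves_cderive r : 0 < r -> (r%:E < b)%E -> cderivable u r /\ cderive u r = p r.
Proof.
move=> r0 rb; have [y ry yb] := lte_right rb; have r2 : 0 < r / 2 by lra.
have le : r / 2 <= y by lra.
have [_ [P1 P2] _] := S r2 le yb.
have [_ _ c1 c2] := solves_continuous r0 rb.
have r2r : r / 2 < r by lra.
have D1 := prim_is_derive P1 r2r ry c1; have D2 := prim_is_derive P2 r2r ry c2.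
split.
  by split; [case: D1 | case: D2].
rewrite /cderive !derive1E (@derive_val _ _ _ _ _ _ _ D1) (@derive_val _ _ _ _ _ _ _ D2).
by case: (p r).
Qed.

Lemma solves_solution : solution q b z u.
Proof.
split; first by move=> r r0 rb; have [] := solves_cderive r0 rb.
move=> x y x0 xy yb.
have [_ Ex] := solves_cderive x0 (lte_le_trans_fin xy yb).
have [_ Ey] := solves_cderive (lt_le_trans x0 xy) yb.
have [_ _ [[_ H1] [_ H2]]] := S x0 xy yb.
rewrite Ex Ey; apply: complex_eq.
- by rewrite ReB (H1 x y).
- by rewrite ImB (H2 x y).
Qed.

Lemma solves_conj : solves b q (z^*) (fun r => (u r)^*) (fun r => (p r)^*).
Proof.
move=> x y x0 xy yb; have [qi Pu Pp] := S x0 xy yb.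
split=> //; first exact: cprim_conj.
by apply: cprim_ext (cprim_conj Pp) _ _ => // r _; exact: conj_coef.
Qed.

(** Uniqueness for the initial value problem: by Gronwall in both directions, vanishing data at one
    point would force [u] to vanish everywhere. *)
Lemma energy_gt0 : nonzero_on b u -> forall r, 0 < r -> (r%:E < b)%E -> 0 < nsq (u r) + nsq (p r).
Proof.
move=> [x [x0 xb ux]] r r0 rb.
rewrite lt_neqAle addr_ge0 ?nsq_ge0 // andbT eq_sym; apply/eqP => E.
have : nsq (u x) + nsq (p x) <= 0.
  have [xr|/ltW rx] := leP x r.
  - by have := energy_bwd xr (S x0 xr rb); rewrite E mul0r.
  - by have := energy_fwd rx (S r0 rx xb); rewrite E mul0r.
have := nsq_ge0 (p x) => h1 h2; have : nsq (u x) <= 0 by lra.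
move=> h3; have : nsq (u x) = 0 by apply/eqP; rewrite eq_le h3 nsq_ge0.
by move/nsq_eq0/eqP; rewrite (negbTE ux).
Qed.

(** This is the Wronskian of [conj u] and [u] divided by 2 i. Where [u] does not vanish, its sign is
    that of [Im (u' / u)], so positivity is the Herglotz property of the m-function. *)
Definition flux r := complex.Im ((u r)^* * p r).

Lemma flux_le x y : 0 <= complex.Im z -> 0 < x -> x <= y -> (y%:E < b)%E -> flux y <= flux x.
Proof.
move=> z0 x0 xy yb; have P := lagrange (S x0 xy yb).
have := prim_le xy P (prim_cst x y 0); rewrite [0 - 0]subr0 subr_le0; apply.
by move=> r _; rewrite mulNr oppr_le0 mulr_ge0 ?nsq_ge0.
Qed.

Definition negative_flux x l :=
  [/\ 0 < x, (x%:E < b)%E, 0 < l & forall y, x <= y -> (y%:E < b)%E -> flux y <= - l].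

(** A flux that is nonpositive at [x1] is negative a little later. Otherwise it would vanish on a
    whole interval, whence [u = 0] there by the Lagrange identity, then [p = 0], against
    [energy_gt0]. *)
Lemma flux_neg_end : 0 < complex.Im z -> nonzero_on b u ->
  ~ (forall r, 0 < r -> (r%:E < b)%E -> 0 < flux r) ->
  exists x l, negative_flux x l.
Proof.
move=> z0 nz H.
have [x1 [x10 x1b fx1]] : exists x1, [/\ 0 < x1, (x1%:E < b)%E & flux x1 <= 0].
  apply: contrapT => K; apply: H => r r0 rb; rewrite ltNge; apply/negP => fr.
  by apply: K; exists r.
have [x xx xb] := lte_right x1b.
have x0 : 0 < x by apply: lt_trans xx.
have zz := ltW z0.
have fx : flux x <= flux x1 by apply: flux_le => //; exact: ltW.
have [fneg|] := ltP (flux x) 0.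
  exists x, (- flux x); split=> //; first by lra.
  by move=> y xy yb; rewrite opprK; exact: flux_le.
move=> fpos; exfalso.
have S1 := S x10 (ltW xx) xb.
have [_ Pu Pp] := S1.
have u0 r : x1 < r < x -> u r = 0.
  move=> /andP[h1 h2]; have r0 := lt_trans x10 h1.
  have rb := lte_le_trans_fin (ltW h2) xb.
  have : - complex.Im z * nsq (u r) = 0.
    apply: (prim_cst_eq0 (k := 0) (lagrange S1)) h1 h2 _.
      move=> t /andP[k1 k2]; apply/eqP; rewrite eq_le -/(flux t).
      have t0 := lt_trans x10 k1; have tb := lte_le_trans_fin (ltW k2) xb.
      rewrite (le_trans (flux_le zz x10 (ltW k1) tb)) // (le_trans fpos) //.
      by apply: flux_le => //; exact: ltW.
    have [y ry yb] := lte_right rb; have r2 : 0 < r / 2 by lra.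
    have le : r / 2 <= y by lra.
    have [_ PPu _] := S r2 le yb.
    have cn := prim_continuous (prim_scale (- complex.Im z) (cprim_nsq PPu)).
    by apply: within_interior cn _ _; lra.
  by move/eqP; rewrite mulf_eq0 oppr_eq0 (gt_eqF z0) /= => /eqP /nsq_eq0.
pose m := (x1 + x) / 2.
have m1 : x1 < m by rewrite /m; lra.
have m2 : m < x by rewrite /m; lra.
have m0 := lt_trans x10 m1.
have mb := lte_le_trans_fin (ltW m2) xb.
have [_ _ c1 c2] := solves_continuous m0 mb.
have [P1 P2] := Pu.
have pm : p m = 0.
  apply: complex_eq.
  - by apply: (prim_cst_eq0 (k := 0) P1) m1 m2 c1 => t /u0 ->.
  - by apply: (prim_cst_eq0 (k := 0) P2) m1 m2 c2 => t /u0 ->.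
have := energy_gt0 nz m0 mb.
by rewrite pm u0 ?m1 // /nsq /= !expr0n /= !addr0 ltxx.
Qed.

End EverySolution.

Lemma antiderivative f : (forall x y, 0 < x -> L1 x y f) ->
  exists F, forall x y, 0 < x -> prim x y F f.
Proof.
(* One of the two integrals is always 0, so the difference is the signed integral from the base
   point 1. *)
move=> fi; exists (fun r => int f 1 r - int f r 1) => x y x0; split; first exact: fi.
move=> s t xs st ty; have s0 := lt_le_trans x0 xs.
have empty (a c : R) : c < a -> int f a c = 0.
  by move=> ca; rewrite /int set_itv_ge ?bnd_simp -?ltNge // Rintegral_set0.
have [s1|s1] := leP 1 s.
  have -> : int f s 1 = 0.
    by move: s1; rewrite le_eqVlt => /predU1P[<-|/empty//]; rewrite int_point.
  have -> : int f t 1 = 0.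
    by move: (le_trans s1 st); rewrite le_eqVlt => /predU1P[<-|/empty//]; rewrite int_point.
  by rewrite (int_cat (fi 1 t ltr01) s1 st); ring.
rewrite (empty _ _ s1).
have [t1|t1] := leP 1 t.
  have -> : int f t 1 = 0.
    by move: t1; rewrite le_eqVlt => /predU1P[<-|/empty//]; rewrite int_point.
  by rewrite (int_cat (fi s t s0) (ltW s1) t1); ring.
rewrite (empty _ _ t1) (int_cat (fi s 1 s0) st (ltW t1)); ring.
Qed.

(* Reduction of order without dividing by [u], which may vanish: the ansatz
   [v = xi u - conj p / N], [v' = xi p + conj u / N] with [N = |u|^2 + |p|^2]
   has Wronskian 1 with [u] and determines [xi']. *)
Lemma second_solution q z u p : solves +oo q z u p -> nonzero_on +oo u ->
  exists v w, solves +oo q z v w /\ forall r, 0 < r -> u r * w r - p r * v r = 1.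
Proof.
move=> S nz.
have N0 r : 0 < r -> 0 < nsq (u r) + nsq (p r) by move=> r0; apply: energy_gt0 S nz _ r0 _; exact: ltry.
pose N r := nsq (u r) + nsq (p r).
pose n r : R[i] := (N r)^-1%:C.
have NC r : (N r)%:C = u r * (u r)^* + p r * (p r)^*.
  rewrite /N /nsq; case: (u r) (p r) => ? ? [? ?]; apply: complex_eq => /=; ring.
have nE r : n r = (u r * (u r)^* + p r * (p r)^*)^-1 by rewrite /n -NC fmorphV.
have SS x y : 0 < x -> x <= y -> sol x y q z u p by move=> x0 xy; apply: S => //; exact: ltry.
pose dN r := (u r)^* * p r + u r * (p r)^* + (p r)^* * (((q r)%:C - z) * u r) + p r * (((q r)%:C - z^*) * (u r)^*).
have Pn x y : 0 < x -> x <= y -> cprim x y n (fun r => - n r ^+ 2 * dN r).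
  move=> x0 xy; have P := prim_inv (energy_prim (SS _ _ x0 xy)).
  apply: cprim_ext (cprim_real (P _)) _ _ => //.
    by move=> r /andP[xr _]; apply: N0; exact: lt_le_trans xr.
  move=> r _; rewrite rmorphM rmorphN fmorphV rmorphXn /= -/(N r) -/(n r) -exprVn -fmorphV -/(n r).
  congr (_ * _); rewrite /dN; clear.
  by case: (u r) (p r) (q r) z => ? ? [? ?] ? [? ?]; apply: complex_eq => /=; ring.
(* Solving [v' = w] for xi' gives [q D1 + D0]. Separating [q] shows local integrability, since [D1]
   and [D0] are continuous. *)
pose D1 r := (((u r)^*) ^+ 2 - ((p r)^*) ^+ 2) * n r ^+ 2.
pose D0 r := ((1 - z^*) * ((u r)^*) ^+ 2 - (1 - z) * ((p r)^*) ^+ 2) * n r ^+ 2.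
pose D r := (q r)%:C * D1 r + D0 r.
have cD x y : 0 < x -> x <= y -> (exists V1, cprim x y D1 V1) /\ (exists V0, cprim x y D0 V0).
  move=> x0 xy; have [_ Pu Pp] := SS _ _ x0 xy; have Pn' := Pn _ _ x0 xy.
  have Pu2 := cprim_mul (cprim_conj Pu) (cprim_conj Pu).
  have Pp2 := cprim_mul (cprim_conj Pp) (cprim_conj Pp).
  have Pn2 := cprim_mul Pn' Pn'.
  split; eexists.
  - exact: cprim_mul (cprim_subf Pu2 Pp2) Pn2.
  - exact: cprim_mul (cprim_subf (cprim_scale _ Pu2) (cprim_scale _ Pp2)) Pn2.
have qi x y : 0 < x -> L1 x y q by move=> x0; apply: (solves_locL1 S) => //; exact: ltry.
have Di x y : 0 < x -> L1 x y (fun r => complex.Re (D r)) /\ L1 x y (fun r => complex.Im (D r)).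
  move=> x0; have [xy|yx] := leP x y; last first.
    by split; rewrite /L1 set_itv_ge ?bnd_simp -?ltNge //; exact: integrable_set0.
  have [[V1 [P1 P2]] [V0 [Q1 Q2]]] := cD x y x0 xy.
  have q' := qi x y x0.
  split.
  - apply: L1_ext (L1_add (L1_mul q' (prim_continuous P1)) (cont_L1 (prim_continuous Q1))) => r _.
    by rewrite /D; case: (D1 r) (D0 r) => ? ? [? ?] /=; ring.
  - apply: L1_ext (L1_add (L1_mul q' (prim_continuous P2)) (cont_L1 (prim_continuous Q2))) => r _.
    by rewrite /D; case: (D1 r) (D0 r) => ? ? [? ?] /=; ring.
have [X1 HX1] := antiderivative (fun x y h => (Di x y h).1).
have [X2 HX2] := antiderivative (fun x y h => (Di x y h).2).
pose xi r := X1 r +i* X2 r.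
have Pxi x y : 0 < x -> cprim x y xi D by move=> x0; split; [exact: HX1 | exact: HX2].
pose v r := xi r * u r - (p r)^* * n r.
pose w r := xi r * p r + (u r)^* * n r.
have Nn0 r : 0 < r -> u r * (u r)^* + p r * (p r)^* != 0.
  by move=> r0; rewrite -NC; apply/eqP => -[] /eqP; rewrite (gt_eqF (N0 r r0)).
exists v, w; split; last first.
  by move=> r r0; rewrite /v /w nE; field; exact: Nn0.
move=> x y x0 xy _; have [_ Pu Pp] := SS _ _ x0 xy; have Pn' := Pn _ _ x0 xy.
split; first exact: qi.
- apply: cprim_ext (cprim_subf (cprim_mul (Pxi x y x0) Pu) (cprim_mul (cprim_conj Pp) Pn')) _ _ => // r /andP[xr _].
  rewrite conj_coef /w /D /D1 /D0 /dN nE; field.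
  exact: Nn0 (lt_le_trans x0 xr).
- apply: cprim_ext (cprim_add (cprim_mul (Pxi x y x0) Pp) (cprim_mul (cprim_conj Pu) Pn')) _ _ => // r /andP[xr _].
  rewrite /v /D /D1 /D0 /dN nE; field.
  exact: Nn0 (lt_le_trans x0 xr).
Qed.

End Weyl.

(** * Positivity of the flux of a Weyl solution *)

Section WeylPositivity.
Variable R : realType.
Implicit Types (f g F G q : R -> R) (x y s t r : R) (u v w p U V : R -> R[i]) (z : R[i]).
Implicit Types (b : \bar R).

Local Notation mu := (@lebesgue_measure R).

Lemma clim_near (F : set_system R) {FF : ProperFilter F} U (l : R[i]) (e : R) :
  clim F U l -> 0 < e -> \forall y \near F, normc (U y - l) < e.
Proof.
move=> [c1 c2] e0; have e2 : 0 < e / 2 by lra.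
move/cvgrPdist_lt: c1 => /(_ _ e2) h1; move/cvgrPdist_lt: c2 => /(_ _ e2) h2.
apply: filterS2 h1 h2 => y h1 h2.
apply: le_lt_trans (normc_le_ReIm _) _; rewrite ReB ImB distrC [X in _ + X]distrC.
by have := ltrD h1 h2; rewrite -splitr.
Qed.

Lemma Im_le_normc z : complex.Im z <= normc z.
Proof. exact: le_trans (ler_norm _) (normr_Im_le z). Qed.

Lemma oppr_Im_le z : - complex.Im z <= normc z.
Proof. by apply: le_trans (normr_Im_le z); rewrite -normrN; exact: ler_norm. Qed.

Lemma Im_conj0_mul z : complex.Im (0^* * z) = 0.
Proof. by case: z => ? ? /=; ring. Qed.

Lemma nsq_continuous b q z u p r : solves b q z u p -> 0 < r -> (r%:E < b)%E ->
  {for r, continuous (fun t => nsq (u t))}.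
Proof.
move=> S r0 rb; have [y ry yb] := lte_right rb; have r2 : 0 < r / 2 by lra.
have le : r / 2 <= y by lra.
have [_ Pu _] := S _ _ r2 le yb.
by apply: within_interior (prim_continuous (cprim_nsq Pu)) _ _; lra.
Qed.

Lemma nsq_measurable q z u p r : solves +oo q z u p -> 0 < r ->
  measurable_fun `[r, +oo[ (fun t => nsq (u t)).
Proof.
move=> S r0; apply: subspace_continuous_measurable_fun => //.
apply: continuous_in_subspaceT => t; rewrite inE /= in_itv /= andbT => rt.
by apply: (nsq_continuous S); [exact: lt_le_trans rt | exact: ltry].
Qed.

Lemma L2_bound q z u p : solves +oo q z u p -> L2_at_infinity u ->
  exists r M, [/\ 0 < r, 0 <= M &
    forall x y, r <= x -> x <= y -> int (fun t => nsq (u t)) x y <= M].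
Proof.
move=> S [r r0 H]; set I := (\int[_]_(x in _) _)%E in H.
have I0 : (0 <= I)%E by apply: integral_ge0 => x _; rewrite lee_fin; exact: nsq_ge0.
have Ifin : I \is a fin_num by rewrite ge0_fin_numE.
exists r, (fine I); split=> //; first exact: fine_ge0.
move=> x y rx xy; rewrite /int /Rintegral.
have sub : (\int[mu]_(t in `[x, y]) (nsq (u t))%:E <= I)%E.
  apply: ge0_subset_integral => //.
  - by apply/measurable_EFinP; exact: nsq_measurable S r0.
  - by move=> t _; rewrite lee_fin nsq_ge0.
  - by move=> t /=; rewrite !in_itv /= andbT => /andP[xt _]; exact: le_trans xt.
apply: fine_le => //; rewrite ge0_fin_numE; first exact: le_lt_trans sub H.
by apply: integral_ge0 => t _; rewrite lee_fin nsq_ge0.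
Qed.

Lemma L2_le q z u p v w (C : R) : solves +oo q z u p -> solves +oo q z v w ->
  L2_at_infinity u -> forall x0 : R, 0 <= C ->
  (forall x, x0 <= x -> nsq (v x) <= C * nsq (u x)) -> L2_at_infinity v.
Proof.
move=> Su Sv [r r0 H] x0 C0 vu; exists (Num.max r x0); first by rewrite lt_max r0.
have m0 : 0 < Num.max r x0 by rewrite lt_max r0.
apply: (@le_lt_trans _ _ (\int[mu]_(x in `[Num.max r x0, +oo[) (C%:E * (nsq (u x))%:E))%E).
  apply: ge0_le_integral => //.
  - by move=> t _; rewrite lee_fin nsq_ge0.
  - by apply/measurable_EFinP; exact: nsq_measurable Sv m0.
  - apply/measurable_EFinP; apply: measurable_funM => //.
    exact: nsq_measurable Su m0.
  - move=> t /=; rewrite in_itv /= andbT ge_max => /andP[_ h].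
    by rewrite -EFinM lee_fin; exact: vu.
rewrite ge0_integralZl_EFin //.
- rewrite lte_mul_pinfty // ?lee_fin //.
  apply: le_lt_trans H; apply: ge0_subset_integral => //.
  - by apply/measurable_EFinP; exact: nsq_measurable Su r0.
  - by move=> t _; rewrite lee_fin nsq_ge0.
  - by move=> t /=; rewrite !in_itv /= !andbT ge_max => /andP[].
- by move=> t _; rewrite lee_fin nsq_ge0.
- by apply/measurable_EFinP; exact: nsq_measurable Su m0.
Qed.

Lemma L2_conj u : L2_at_infinity u -> L2_at_infinity (fun x => (u x)^*).
Proof.
move=> [r r0 H]; exists r => //; apply: le_lt_trans H.
rewrite le_eqVlt; apply/orP; left; apply/eqP; apply: eq_integral => x _.
by case: (u x) => ? ? /=; rewrite sqrrN.
Qed.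

(** The Wronskian of solutions at different energies has derivative [(z1 - z2) u1 u2], which is
    integrable at infinity when both are L2. *)
Lemma wronskian_bounded q z1 z2 u1 p1 u2 p2 :
  solves +oo q z1 u1 p1 -> solves +oo q z2 u2 p2 ->
  L2_at_infinity u1 -> L2_at_infinity u2 ->
  exists r C, 0 < r /\ forall x, r <= x -> normc (u1 x * p2 x - p1 x * u2 x) <= C.
Proof.
move=> S1 S2 L1u L2u.
have [r1 [M1 [r10 M10 H1]]] := L2_bound S1 L1u.
have [r2 [M2 [r20 M20 H2]]] := L2_bound S2 L2u.
set r := Num.max r1 r2; have r0 : 0 < r by rewrite lt_max r10.
set k := normc (z2 - z1).
exists r, (normc (u1 r * p2 r - p1 r * u2 r) + k * (M1 + M2)); split=> // x rx.
have T1 := S1 r x r0 rx (ltry x); have T2 := S2 r x r0 rx (ltry x).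
have PW := wronskian_prim T1 T2.
have L1n z u p : solves +oo q z u p -> L1 r x (fun t => nsq (u t)).
  move=> S; have [_ Pu _] := S r x r0 rx (ltry x).
  exact: cont_L1 (prim_continuous (cprim_nsq Pu)).
have n1 := L1n _ _ _ S1; have n2 := L1n _ _ _ S2.
have Lf : L1 r x (fun t => k / 2 * (nsq (u1 t) + nsq (u2 t))) by apply: L1_scale; exact: L1_add.
have := cprim_bound rx PW Lf; rewrite int_scale; last exact: L1_add.
rewrite int_add // => B.
have {}B : normc (u1 x * p2 x - p1 x * u2 x - (u1 r * p2 r - p1 r * u2 r)) <= k * (M1 + M2).
  apply: le_trans (B _) _.
    move=> t _; rewrite subrr sub0r mulNr normcN !normcM -/k -mulrA ler_wpM2l ?normc_ge0 //.
    by rewrite [leRHS]mulrC; exact: normc_mul_le.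
  rewrite [leLHS](_ : _ = k * (int (fun r0 => nsq (u1 r0)) r x + int (fun r0 => nsq (u2 r0)) r x)); last by field.
  apply: ler_wpM2l; first exact: normc_ge0.
  by apply: lerD; [apply: H1 | apply: H2] => //; rewrite /r le_max lexx ?orbT.
have := le_normcD (u1 r * p2 r - p1 r * u2 r) (u1 x * p2 x - p1 x * u2 x - (u1 r * p2 r - p1 r * u2 r)).
rewrite addrC subrK; lra.
Qed.

Lemma int_le_open (a c x y : R) q : mu.-integrable `]a, c[ (EFin \o q) ->
  a < x -> x <= y -> y < c ->
  int (fun t => `|q t|) x y <= \int[mu]_(t in `]a, c[) `|q t|.
Proof.
move=> /integrable_norm qi ax xy yc; rewrite /int /Rintegral.
have [mq _] := integrableP _ _ _ qi.
have sub : (\int[mu]_(t in `[x, y]) (`|q t|)%:E <= \int[mu]_(t in `]a, c[) (`|q t|)%:E)%E.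
  apply: ge0_subset_integral => //.
  by apply: subset_itv; rewrite bnd_simp.
apply: fine_le => //.
- rewrite ge0_fin_numE; last by apply: integral_ge0.
  apply: le_lt_trans sub _.
  have fin : (\int[mu]_(t in `]a, c[) (`|q t|)%:E)%E \is a fin_num by exact: integrable_fin_num qi.
  rewrite -ge0_fin_numE //; exact: integral_ge0.
- exact: integrable_fin_num qi.
Qed.

(** Since [q] is integrable up to [c], Gronwall keeps [u] and [p] bounded there. As [h] is real,
    adding [h u] to [p] leaves the flux unchanged, so the flux is bounded by a bounded factor times
    one that tends to 0. *)
Lemma no_neg_flux_regular (c : R) q z u p (h : option R) x l :
  mu.-integrable `]0, c[ (EFin \o q) -> solves c%:E q z u p -> 
  boundary_condition (RegularEnd c h) u -> ~ negative_flux c%:E u p x l.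
Proof.
move=> qi S bc [x0 xc l0 H]; rewrite lte_fin in xc.
pose B := \int[mu]_(t in `]0, c[) `|q t|.
pose M := (nsq (u x) + nsq (p x)) * expR ((1 + normc z) * (c - x) + B).
have M0 : 0 <= M by rewrite /M mulr_ge0 ?expR_ge0 // addr_ge0 ?nsq_ge0.
have bnd y : x <= y -> y < c -> nsq (u y) + nsq (p y) <= M.
  move=> xy yc; have yc' : (y%:E < c%:E)%E by rewrite lte_fin.
  apply: le_trans (energy_fwd xy (S x y x0 xy yc')) _.
  apply: ler_wpM2l; first by rewrite addr_ge0 ?nsq_ge0.
  have [q1 _ _] := S x y x0 xy yc'.
  rewrite ler_expR int_add; first 1 last.
  - by apply: cont_L1; apply: continuous_subspaceT => ?; exact: cvg_cst.
  - exact: L1_norm.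
  rewrite int_cst // lerD //; last exact: int_le_open.
  by rewrite ler_wpM2l ?addr_ge0 ?normc_ge0 // lerD2r ltW.
pose N := Num.sqrt M.
have bu y : x <= y -> y < c -> normc (u y) <= N.
  move=> xy yc; rewrite -(@ler_pXn2r _ 2) ?nnegrE ?normc_ge0 ?sqrtr_ge0 // sqr_sqrtr //.
  by rewrite -nsqE; have := bnd y xy yc; have := nsq_ge0 (p y); lra.
have bp y : x <= y -> y < c -> normc (p y) <= N.
  move=> xy yc; rewrite -(@ler_pXn2r _ 2) ?nnegrE ?normc_ge0 ?sqrtr_ge0 // sqr_sqrtr //.
  by rewrite -nsqE; have := bnd y xy yc; have := nsq_ge0 (u y); lra.
have N0 : 0 <= N by exact: sqrtr_ge0.
have e0 : 0 < l / (N + 1) by rewrite divr_gt0 // ltr_pwDr.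
have small (U : R -> R[i]) : clim c^'- U 0 -> exists y, [/\ x <= y, y < c & normc (U y) < l / (N + 1)].
  move=> cl.
  have n1 : \forall y \near c^'-, normc (U y - 0) < l / (N + 1) by exact: clim_near cl e0.
  have n2 := nbhs_left_gt xc; have n3 := nbhs_left_lt c.
  have [y [k1 k2 k3]] : exists y, [/\ normc (U y - 0) < l / (N + 1), x < y & y < c].
    have [y [? [? ?]]] : exists y, normc (U y - 0) < l / (N + 1) /\ x < y /\ y < c.
      by apply: (@filter_ex _ _ (at_left_proper_filter c)); exact: filterI n1 (filterI n2 n3).
    by exists y.
  by exists y; split => //; [exact: ltW | rewrite -[U y]subr0].
have fin_ (a d : R[i]) : normc a <= N -> normc d < l / (N + 1) -> `|complex.Im (a^* * d)| < l.
  move=> ha hd; apply: le_lt_trans (normr_Im_le _) _; rewrite normcM normc_conj.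
  apply: (@le_lt_trans _ _ (N * (l / (N + 1)))).
    by apply: ler_pM => //; rewrite ?normc_ge0 // ltW.
  rewrite mulrA ltr_pdivrMr ?ltr_pwDr // mulrDr mulr1 mulrC; lra.
case: h bc => [h|] /= bc.
- have [y [xy yc hy]] := small _ bc.
  have yc' : (y%:E < c%:E)%E by rewrite lte_fin.
  have yp := lt_le_trans x0 xy.
  have [_ Ey] := solves_cderive S yp yc'.
  have := fin_ _ _ (bu y xy yc) hy; rewrite Ey.
  have -> : complex.Im ((u y)^* * (p y + h%:C * u y)) = flux u p y.
    by rewrite /flux; case: (u y) (p y) => ? ? [? ?] /=; ring.
  by rewrite ltr_norml => /andP[h1 _]; have := H y xy yc'; lra.
- have [y [xy yc hy]] := small _ bc.
  have yc' : (y%:E < c%:E)%E by rewrite lte_fin.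
  have := fin_ _ _ (bp y xy yc) hy.
  have -> : complex.Im ((p y)^* * u y) = - flux u p y.
    by rewrite /flux; case: (u y) (p y) => ? ? [? ?] /=; ring.
  by rewrite normrN ltr_norml => /andP[h1 _]; have := H y xy yc'; lra.
Qed.

(** A Weyl disk argument. Let [v] have Wronskian 1 with [u]. For each [y >= x] take [J] with
    [v y = J u y]: then [v - J u] has zero flux at [y], hence nonnegative flux at [x]. This is a
    quadratic inequality in |J| with leading coefficient at most [- l], so |J| is bounded uniformly
    in [y]. Thus |v| <= C |u| and [v] is L2, so limit point uniqueness makes [v] a multiple of [u],
    against Wronskian 1. *)
Lemma no_neg_flux_limit_point q z u p x l : 0 < complex.Im z ->
  limit_point_at_infinity q -> solves +oo q z u p -> nonzero_on +oo u ->
  L2_at_infinity u -> ~ negative_flux +oo u p x l.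
Proof.
move=> z0 LP S nz Lu [x0 _ l0 H].
have [v [w [Sv W]]] := second_solution S nz.
pose al := normc (v x) * normc (p x) + normc (u x) * normc (w x).
pose be := normc (v x) * normc (w x).
have al0 : 0 <= al by rewrite addr_ge0 ?mulr_ge0 ?normc_ge0.
have be0 : 0 <= be by rewrite mulr_ge0 ?normc_ge0.
(* Bounds every |J| with [l |J|^2 <= al |J| + be]: either |J| <= 1, or [be <= be |J|] and one factor
   |J| cancels. *)
pose C := (al + be) / l + 1.
have C0 : 0 <= C by rewrite /C addr_ge0 // divr_ge0 ?(ltW l0) // addr_ge0.
have bnd y : x <= y -> nsq (v y) <= C ^+ 2 * nsq (u y).
  move=> xy; have yi : (y%:E < +oo)%E := ltry y.
  have uy : u y != 0.
    apply/eqP => uy; have := H y xy yi; rewrite /flux uy Im_conj0_mul; lra.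
  have [J EJ] : exists J, v y = J * u y by exists (v y / u y); rewrite divfK.
  have Sw := sol_lin (- J) (Sv x y x0 xy yi) (S x y x0 xy yi).
  have wy : v y + - J * u y = 0 by rewrite EJ mulNr subrr.
  have := prim_le xy (lagrange Sw) (prim_cst x y 0).
  rewrite [0 - 0]subr0 subr_le0 wy Im_conj0_mul => K.
  have {}K : 0 <= complex.Im ((v x + - J * u x)^* * (w x + - J * p x)).
    by apply: K => r _; rewrite mulNr oppr_le0 mulr_ge0 ?nsq_ge0 // ltW.
  have E : complex.Im ((v x + - J * u x)^* * (w x + - J * p x)) =
      normc J ^+ 2 * flux u p x - complex.Im (J * ((v x)^* * p x)) - complex.Im (J^* * ((u x)^* * w x))
      + complex.Im ((v x)^* * w x).
    rewrite sqr_normcE /flux; case: (u x) (p x) (v x) (w x) (J) => ? ? [? ?] [? ?] [? ?] [? ?] /=; ring.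
  move: K; rewrite E => K.
  have k1 := Im_le_normc ((v x)^* * w x).
  have k2 := oppr_Im_le (J * ((v x)^* * p x)).
  have k3 := oppr_Im_le (J^* * ((u x)^* * w x)).
  have fx := H x (lexx x) (ltry x).
  rewrite !normcM !normc_conj in k1 k2 k3.
  have J0 := normc_ge0 J.
  have key : l * normc J ^+ 2 <= al * normc J + be.
    have : normc J ^+ 2 * flux u p x <= normc J ^+ 2 * - l by rewrite ler_wpM2l ?sqr_ge0.
    rewrite /al /be; lra.
  have C1 : 0 <= (al + be) / l by rewrite divr_ge0 ?(ltW l0) // addr_ge0.
  have JC : normc J <= C.
    have [J1|J1] := leP (normc J) 1.
      by rewrite /C; lra.
    have Jp : 0 < normc J by lra.
    have : l * normc J <= al + be.
      rewrite -(ler_pM2r Jp); apply: (@le_trans _ _ (l * normc J ^+ 2)); first by rewrite expr2 mulrA.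
      apply: le_trans key _; have := ler_peMr be0 (ltW J1); lra.
    rewrite mulrC -ler_pdivlMr // /C; lra.
  rewrite EJ !nsqE normcM exprMn ler_wpM2r ?sqr_ge0 // ler_pXn2r ?nnegrE //.
have Lv := L2_le S Sv Lu (sqr_ge0 C) bnd.
have [us [_ _ _ uniq]] := LP z z0.
have [c1 E1] := uniq _ (solves_solution S) Lu.
have [c2 E2] := uniq _ (solves_solution Sv) Lv.
have [y [y0 _ uy]] := nz.
have c10 : c1 != 0 by apply: contra uy => /eqP c10; rewrite E1 // c10 mul0r.
pose la := c2 / c1.
have vla t : 0 < t -> v t = la * u t.
  by move=> t0; rewrite E1 // E2 // mulrA /la divfK.
have wla : w 1 = la * p 1.
  have h2 : (0 : R) < 2^-1 by rewrite invr_gt0.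
  have h12 : (2^-1 : R) <= 2 by lra.
  have Sw := sol_lin (- la) (Sv _ _ h2 h12 (ltry _)) (S _ _ h2 h12 (ltry _)).
  have [_ [P1 P2] _] := Sw.
  have [_ _ c3 c4] := solves_continuous (fun x y hx hxy hb => sol_lin (- la) (Sv x y hx hxy hb) (S x y hx hxy hb)) (ltr01 : (0 : R) < 1) (ltry _).
  have i1 : (2^-1 : R) < 1 by lra.
  have i2 : (1 : R) < 2 by lra.
  have z1 t : 2^-1 < t < 2 -> v t + - la * u t = 0.
    by move=> /andP[ht _]; rewrite vla ?mulNr ?subrr //; exact: lt_trans ht.
  have e1 := prim_cst_eq0 (k := 0) P1 (fun t ht => congr1 _ (z1 t ht)) i1 i2 c3.
  have e2 := prim_cst_eq0 (k := 0) P2 (fun t ht => congr1 _ (z1 t ht)) i1 i2 c4.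
  apply/eqP; rewrite -subr_eq0 -mulNr; apply/eqP; exact: complex_eq.
have := W 1 ltr01; rewrite wla vla // => /eqP.
rewrite [u 1 * _ - _](_ : _ = 0); last by ring.
by rewrite eq_sym oner_eq0.
Qed.

(** Write [x, y] for the determinant [x * y' - x' * y]. The Plucker relation expresses [c, conj a]
    [conj c, a] through products that each contain a small factor, [conj c, c] or [c, a]; this
    yields [t]. Expanding [a, conj a] in the basis [c, d], which has determinant 1, makes the flux
    of [a] small too. *)
Lemma plucker_bound (a a' c c' d d' : R[i]) (C e : R) : c * d' - c' * d = 1 ->
  0 < C -> 0 <= e -> e <= 1 ->
  normc (c^* * c' - c'^* * c) <= e -> normc (c * a' - c' * a) <= e ->
  normc (a * d' - a' * d) <= C -> normc (a^* * d' - a'^* * d) <= C ->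
  normc (a * a'^* - a' * a^*) <= C ->
  exists t, [/\ 0 <= t, t ^+ 2 <= e * (C + 1) & 2 * `|complex.Im (a^* * a')| <= C * e + C * t].
Proof.
move=> W C0 e0 e1 h1 h2 B1 B2 B3.
have conj_wr (x x' y y' : R[i]) : normc (x^* * y' - x'^* * y) = normc (x * y'^* - x' * y^*).
  rewrite -normc_conj; congr normc.
  by case: x x' y y' => ? ? [? ?] [? ?] [? ?]; apply: complex_eq => /=; ring.
pose t := normc (c * a'^* - c' * a^*).
exists t; have t0 : 0 <= t by exact: normc_ge0.
have plucker : (c * a'^* - c' * a^*) * (c^* * a' - c'^* * a) =
  (c^* * c' - c'^* * c) * (a * a'^* - a' * a^*) + (c * a' - c' * a) * (c^* * a'^* - c'^* * a^*) by ring.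
split=> //.
  rewrite expr2 -[X in _ * X]conj_wr -normcM plucker; apply: le_trans (le_normcD _ _) _.
  rewrite !normcM mulrDr mulr1; apply: lerD.
    by apply: ler_pM; rewrite ?normc_ge0.
  have -> : normc (c^* * a'^* - c'^* * a^*) = normc (c * a' - c' * a).
    rewrite -[RHS]normc_conj; congr normc; clear.
    by case: a a' c c' => ? ? [? ?] [? ?] [? ?]; apply: complex_eq => /=; ring.
  rewrite -[leRHS]mulr1.
  by apply: ler_pM; rewrite ?normc_ge0 //; exact: le_trans h2 e1.
apply: (@le_trans _ _ (normc (a * a'^* - a' * a^*))).
  apply: le_trans (normr_Im_le _).
  have -> : complex.Im (a * a'^* - a' * a^*) = - 2 * complex.Im (a^* * a').
    by clear; case: a a' => ? ? [? ?] /=; ring.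
  by rewrite normrM normrN [`|2|]ger0_norm.
have -> : a * a'^* - a' * a^* =
    (a * c' - a' * c) * (a^* * d' - a'^* * d) - (a * d' - a' * d) * (a^* * c' - a'^* * c).
  by rewrite -[LHS]mulr1 -W; ring.
apply: le_trans (le_normcD _ _) _; rewrite normcN !normcM.
have -> : a * c' - a' * c = - (c * a' - c' * a) by ring.
have -> : a^* * c' - a'^* * c = - (c * a'^* - c' * a^*) by ring.
rewrite !normcN -/t [X in X + _]mulrC.
by apply: lerD; apply: ler_pM; rewrite ?normc_ge0.
Qed.

(** All solutions are L2, so the Wronskians among [u], its conjugate and a companion [f] of [u0]
    stay bounded although the energies differ. The two boundary limits then force the flux towards 0
    through [plucker_bound]. *)
Lemma no_neg_flux_limit_circle q z u p u0 x l : 0 < complex.Im z ->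
  limit_circle_at_infinity q -> solves +oo q z u p -> nonzero_on +oo u ->
  solves +oo q (0 +i* 1) u0 (cderive u0) -> nonzero_on +oo u0 ->
  clim +oo%R (wronskian (fun x => (u0 x)^*%C) u0) 0 ->
  clim +oo%R (wronskian u0 u) 0 -> ~ negative_flux +oo u p x l.
Proof.
move=> z0 LC S nz S0 nz0 cl0 cl [x0 _ l0 H].
have [f [f' [Sf Wf]]] := second_solution S0 nz0.
have i0 : 0 < complex.Im (0 +i* 1 : R[i]) by exact: ltr01.
have Lu := LC _ z0 _ (solves_solution S).
have Lf := LC _ i0 _ (solves_solution Sf).
have [r1 [C1 [r10 B1]]] := wronskian_bounded S Sf Lu Lf.
have [r2 [C2 [r20 B2]]] := wronskian_bounded (solves_conj S) Sf (L2_conj Lu) Lf.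
have [r3 [C3 [r30 B3]]] := wronskian_bounded S (solves_conj S) Lu (L2_conj Lu).
pose C := 1 + `|C1| + `|C2| + `|C3|.
have C0 : 0 < C by rewrite /C -!addrA ltr_pwDl // !addr_ge0.
(* Chosen so that [C e <= l / 2] and [(C t)^2 <= l^2 / 2]; then [C e + C t < 2 l], whereas twice the
   flux is at least [2 l] in modulus. *)
pose e := Num.min 1 (Num.min (l / (2 * C)) (l ^+ 2 / (2 * (C ^+ 2 * (C + 1))))).
have e0 : 0 < e.
  rewrite /e !lt_min ltr01 /=; apply/andP; split; first by rewrite divr_gt0 ?mulr_gt0.
  apply: divr_gt0; first exact: exprn_gt0.
  by apply: mulr_gt0 => //; apply: mulr_gt0; [exact: exprn_gt0 | lra].
have [y [y1 y2 y3 [y4 [y5 y6]]]] : exists y, [/\ normc (wronskian (fun x => (u0 x)^*%C) u0 y - 0) < e,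
    normc (wronskian u0 u y - 0) < e, x < y & [/\ r1 < y, r2 < y & r3 < y]].
  have n1 : \forall y \near +oo%R, normc (wronskian (fun x => (u0 x)^*%C) u0 y - 0) < e.
    exact: clim_near cl0 e0.
  have n2 : \forall y \near +oo%R, normc (wronskian u0 u y - 0) < e by exact: clim_near cl e0.
  have n3 t : \forall y \near +oo%R, t < y := nbhs_pinfty_gt (num_real t).
  have [y [? [? [? [? [? ?]]]]]] : exists y, normc (wronskian (fun x => (u0 x)^*%C) u0 y - 0) < e /\
      normc (wronskian u0 u y - 0) < e /\ x < y /\ r1 < y /\ r2 < y /\ r3 < y.
    by exact: (filter_ex (filterI n1 (filterI n2 (filterI (n3 x) (filterI (n3 r1) (filterI (n3 r2) (n3 r3))))))).
  by exists y; split.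
have yp : 0 < y by apply: lt_trans y3.
rewrite subr0 /wronskian (solves_cderive (solves_conj S0) yp (ltry y)).2 in y1.
rewrite subr0 /wronskian (solves_cderive S yp (ltry y)).2 in y2.
have {B1} := B1 y (ltW y4); have {B2} := B2 y (ltW y5); have {B3} := B3 y (ltW y6).
have := Wf y yp; have := H y (ltW y3) (ltry y).
have Cle (D : R) : D \in [:: C1; C2; C3] -> D <= C.
  rewrite !inE /C => /or3P[] /eqP ->; have := ler_norm C1; have := ler_norm C2; have := ler_norm C3;
  have := normr_ge0 C1; have := normr_ge0 C2; have := normr_ge0 C3; lra.
move=> Hy W B3 B2 B1.
have {}B1 := le_trans B1 (Cle _ (mem_head _ _)).
have {}B2 : normc ((u y)^* * f' y - (p y)^* * f y) <= C by apply: le_trans B2 (Cle _ _); rewrite !inE eqxx orbT.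
have {}B3 : normc (u y * (p y)^* - p y * (u y)^*) <= C by apply: le_trans B3 (Cle _ _); rewrite !inE eqxx !orbT.
have e1' : e <= 1 by rewrite /e !ge_min lexx.
have [t [t0 t2 tri]] := plucker_bound W C0 (ltW e0) e1' (ltW y1) (ltW y2) B1 B2 B3.
have two_l : l <= `|complex.Im ((u y)^* * p y)|.
  by rewrite -normrN; apply: le_trans (ler_norm _); rewrite lerNr.
have e1 : e <= l / (2 * C) by rewrite /e !ge_min lexx !orbT.
have e2 : e <= l ^+ 2 / (2 * (C ^+ 2 * (C + 1))) by rewrite /e !ge_min lexx !orbT.
have Cp : 0 < C + 1 by lra.
have {}e1 : 2 * (C * e) <= l.
  by move: e1; rewrite ler_pdivlMr ?mulr_gt0 // => e1; lra.
have {}e2 : 2 * (C ^+ 2 * (e * (C + 1))) <= l ^+ 2.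
  move: e2; rewrite ler_pdivlMr; first by move=> e2; lra.
  by apply: mulr_gt0 => //; apply: mulr_gt0 => //; exact: exprn_gt0.
have {}t2 : (C * t) ^+ 2 <= C ^+ 2 * (e * (C + 1)).
  by rewrite exprMn ler_wpM2l ?sqr_ge0.
have Ct : C * t < l.
  rewrite ltNge; apply/negP => lCt.
  have h1 : l ^+ 2 <= (C * t) ^+ 2.
    by rewrite ler_pXn2r ?nnegrE // ?mulr_ge0 // ltW.
  have h2 : 0 < l ^+ 2 by exact: exprn_gt0.
  clear - h1 h2 t2 e2; lra.
clear - tri Ct two_l e1 l0; lra.
Qed.

End WeylPositivity.

(** * The bounded-below case, and a lower bound for |u| against |u'| *)

Section WeylMFunction.
Variable R : realType.
Implicit Types (f g F G q : R -> R) (x y s t r : R) (u v w p U V : R -> R[i]) (z : R[i]).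
Implicit Types (b : \bar R).

Local Notation mu := (@lebesgue_measure R).

(* The negative part of [q] is a bounded function plus the derivative of [Q - S], where
   [Q' = max (- q) 0] and [S] is the unit-window average of [Q]; this makes
   [Re (conj u p) + (Q - S) |u|^2] grow linearly when the flux stays away from 0. *)
Lemma no_neg_flux_bounded_below q z u p x l :
  neg_part_unif_L1 q -> solves +oo q z u p -> L2_at_infinity u ->
  ~ negative_flux +oo u p x l.
Proof.
move=> nq S Lu [x0 _ l0 H].
pose qm t := Num.max (- q t) 0.
have [D [D0 HD]] : exists D, 0 <= D /\ forall r, 0 < r -> int qm r (r + 1) <= D.
  move: nq; rewrite /neg_part_unif_L1; set A := [set _ | _ in _] => nq.
  have ub := @ereal_sup_ubound R A.
  have A0 r : 0 < r -> (0 <= \int[mu]_(t in `[r, (r + 1)%R]) (qm t)%:E)%E.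
    by move=> r0; apply: integral_ge0 => t _; rewrite lee_fin le_max lexx orbT.
  have Ain r : 0 < r -> (\int[mu]_(t in `[r, (r + 1)%R]) (qm t)%:E <= ereal_sup A)%E.
    by move=> r0; apply: ub; exists r.
  have s0 : (0 <= ereal_sup A)%E by apply: le_trans (A0 1 ltr01) (Ain 1 ltr01).
  have sf : ereal_sup A \is a fin_num by rewrite ge0_fin_numE.
  exists (fine (ereal_sup A)); split; first exact: fine_ge0.
  move=> r r0; apply: fine_le => //; last exact: Ain.
  by rewrite ge0_fin_numE ?A0 //; exact: le_lt_trans (Ain r r0) nq.
have qi s t : 0 < s -> L1 s t q by move=> s0; apply: (solves_locL1 S) => //; exact: ltry.
have qmi s t : 0 < s -> L1 s t qm.
  move=> s0; have h := qi s t s0.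
  apply: L1_ext (L1_scale 2^-1 (L1_sub_fun (L1_norm h) h)) => r _; rewrite /qm.
  by case: (leP (- q r) 0) => k; [rewrite ger0_norm | rewrite ltr0_norm]; lra.
have qm0 t : 0 <= qm t by rewrite /qm le_max lexx orbT.
have qmq t : 0 <= q t + qm t by rewrite /qm; case: (leP (- q t) 0) => h; lra.
have [Q HQ] := antiderivative qmi.
have Qmon s t : 0 < s -> s <= t -> Q s <= Q t.
  move=> s0 st; rewrite -subr_ge0; have [_ ->] := HQ s t s0 => //; exact: int_ge0.
have Q1 s : 0 < s -> Q (s + 1) <= Q s + D.
  move=> s0; have [_ E] := HQ s (s + 1) s0.
  have s1 : s <= s + 1 by lra.
  by have := E s (s + 1) (lexx _) s1 (lexx _); have := HD s s0; lra.
have cQ r : 0 < r -> {for r, continuous Q}.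
  move=> r0; have r2 : 0 < r / 2 by lra.
  by apply: within_interior (prim_continuous (HQ (r / 2) (r + 1) r2)) _ _; lra.
have Qi s t : 0 < s -> L1 s t Q.
  move=> s0; apply: cont_L1; apply: continuous_within_itv => r /andP[sr _].
  by apply: cQ; exact: lt_le_trans sr.
have [T HT] := antiderivative Qi.
have dT r : 0 < r -> is_derive r 1 T (Q r).
  move=> r0; have r2 : 0 < r / 2 by lra.
  by apply: prim_is_derive (HT (r / 2) (r + 1) r2) _ _ (cQ r r0); lra.
pose W r := T (r + 1) - T r.
have shift r : is_derive r 1 (fun t : R => t + 1) 1.
  have := is_deriveD (is_derive_id r 1) (is_derive_cst (1 : R) r 1).
  by rewrite addr0.
have PW s t : 0 < s -> prim s t W (fun r => Q (r + 1) - Q r).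
  move=> s0; apply: prim_subf; last exact: HT.
  have s1 : 0 < s + 1 by lra.
  have := @prim_comp R s t (fun r => r + 1) (fun=> 1) `]0, +oo[ T Q.
  have PI : prim s t (fun r => r + 1) (fun=> 1).
    by apply: prim_ext (prim_add (prim_id s t) (prim_cst s t 1)) _ _ => // r _; rewrite addr0.
  move=> /(_ PI) K; apply: prim_ext (K _ _ _) _ _.
  - by move=> r /andP[sr _]; rewrite in_itv /= andbT ltr_wpDr // (lt_le_trans s0).
  - by move=> r; rewrite in_itv /= andbT; exact: dT.
  - by move=> r; rewrite in_itv /= andbT; exact: cQ.
  - by [].
  - by move=> r _; rewrite mulr1.
have WQ r : 0 < r -> Q r <= W r <= Q r + D.
  move=> r0; have r1 : r <= r + 1 by lra.
  have [_ E] := HT r (r + 1) r0.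
  rewrite /W (E r (r + 1)) //.
  have Li (k : R) : L1 r (r + 1) (fun=> k).
    by apply: cont_L1; apply: continuous_subspaceT => ?; exact: cvg_cst.
  have e1 (k : R) : int (fun=> k) r (r + 1) = k by rewrite int_cst //; ring.
  apply/andP; split.
  - rewrite -[leLHS]e1; apply: int_le => //; first exact: Qi.
    by move=> t /andP[rt _]; exact: Qmon.
  - rewrite -[leRHS]e1; apply: int_le => //; first exact: Qi.
    move=> t /andP[rt tr]; apply: le_trans (Q1 r r0); apply: Qmon => //.
    exact: lt_le_trans rt.
have [r [M [r0 M0 HM]]] := L2_bound S Lu.
set a := Num.max x r.
have a0 : 0 < a by rewrite lt_max x0.
have xa : x <= a by rewrite le_max lexx.
have ra : r <= a by rewrite le_max lexx orbT.
pose G t := complex.Re ((u t)^* * p t) + (Q t - W t) * nsq (u t).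
(* The cross term costs half of |p|^2 and [2 D^2 |u|^2]; the potential and the derivative of [W]
   cost [(D + |z|) |u|^2]. The other half of |p|^2 is at least [l - |u|^2 / 2], because |u| |p| >=
   l. *)
pose K := 1 / 2 + normc z + D + 2 * D ^+ 2.
have growth X : a <= X -> l * (X - a) - K * M + G a <= G X.
  move=> aX; have [_ Pu Pp] := S a X a0 aX (ltry _).
  have P1 := cprim_Re (cprim_mul (cprim_conj Pu) Pp).
  have P2 := prim_mul (prim_subf (HQ a X a0) (PW a X a0)) (cprim_nsq Pu).
  have PG := prim_add P1 P2.
  have Pn := prim_int (cont_L1 (prim_continuous (cprim_nsq Pu))).
  have PL := prim_subf (prim_scale l (prim_id a X)) (prim_scale K Pn).
  have := prim_le aX PL PG; rewrite int_point mulr0 subr0 => Hle.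
  have IM := HM a X ra aX.
  have K0 : 0 <= K by rewrite /K !addr_ge0 ?normc_ge0 ?mulr_ge0 ?sqr_ge0.
  have := ler_wpM2l K0 IM.
  suff : l * id X - K * int (fun r0 => nsq (u r0)) a X - l * id a <= G X - G a by rewrite /=; clear; lra.
  apply: Hle => t /andP[at_ tX].
  have t0 : 0 < t by exact: lt_le_trans at_.
  have fx := H t (le_trans xa at_) (ltry t).
  have /andP[w1 w2] := WQ t t0; have q1 := Q1 t t0; have q2 := qmq t.
  have rz := le_trans (ler_norm _) (normr_Re_le z).
  have n0 := nsq_ge0 (u t); have m0 := nsq_ge0 (p t).
  have e1 : complex.Re ((p t)^* * p t + (u t)^* * (((q t)%:C - z) * u t)) =
      nsq (p t) + (q t - complex.Re z) * nsq (u t).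
    by rewrite /nsq; clear; case: (u t) (p t) (z) => ? ? [? ?] [? ?] /=; ring.
  have e2 : 2 * complex.Re ((u t)^* * p t) * (Q t - W t) >= - (1 / 2 * nsq (p t) + 2 * D ^+ 2 * nsq (u t)).
    have h := normr_Re_le ((u t)^* * p t); rewrite normcM normc_conj in h.
    have h1 : `|2 * complex.Re ((u t)^* * p t) * (Q t - W t)| <= 2 * (normc (u t) * normc (p t)) * D.
      rewrite !normrM [`|2|]ger0_norm // ler_pM ?mulr_ge0 //; first by rewrite ler_wpM2l.
      by rewrite ler_norml; apply/andP; split; clear - w1 w2 D0; lra.
    have h2 : 2 * (normc (u t) * normc (p t)) * D <= 1 / 2 * nsq (p t) + 2 * D ^+ 2 * nsq (u t).
      rewrite !nsqE; have := sqr_ge0 (normc (p t) - 2 * D * normc (u t)).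
      by rewrite sqrrB; clear; lra.
    by have := le_trans h1 h2; rewrite ler_norml => /andP[].
  have e3 : 2 * l <= nsq (u t) + nsq (p t).
    have h : l <= normc (u t) * normc (p t).
      have := oppr_Im_le ((u t)^* * p t); rewrite normcM normc_conj; rewrite /flux in fx; clear - fx; lra.
    by have := normc_mul_le (u t) (p t); clear - h; lra.
  rewrite e1; move: e2; set E := _ * (Q t - W t) => e2.
  have e4 : (qm t - (Q (t + 1) - Q t)) * nsq (u t) + (q t - complex.Re z) * nsq (u t) >=
      - (D + normc z) * nsq (u t).
    by rewrite -mulrDl; apply: ler_wpM2r => //; clear - q1 q2 rz; lra.
  rewrite [(Q t - W t) * _](_ : _ = E); last by rewrite /E; ring.
  move: e4; rewrite mulr1 /K; clear - e2 e3; lra.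
have [m0 [m1 m2]] : exists X0 : R, [/\ a <= X0 & forall X, X0 <= X -> 1 <= G X].
  exists (a + (1 + `|K * M - G a|) / l).
  have d0 : 0 <= (1 + `|K * M - G a|) / l by rewrite divr_ge0 ?addr_ge0 // ltW.
  split; first lra.
  move=> X hX; apply: le_trans (growth X _); last by lra.
  have : (1 + `|K * M - G a|) / l <= X - a by lra.
  rewrite ler_pdivrMr // => h; have := ler_norm (K * M - G a); clear - h; lra.
have mp : 0 < m0 by exact: lt_le_trans m1.
(* As [Q <= W], [G >= 1] forces [Re (conj u p) >= 1], so |u|^2 grows at rate at least 2, which is
   incompatible with L2. *)
have big X : m0 <= X -> 2 * (X - m0) <= nsq (u X).
  move=> mX; have [_ Pu Pp] := S m0 X mp mX (ltry _).
  have := prim_le mX (prim_scale 2 (prim_id m0 X)) (cprim_nsq Pu) => K1.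
  suff : 2 * id X - 2 * id m0 <= nsq (u X) - nsq (u m0).
    by have := nsq_ge0 (u m0); rewrite /=; clear; lra.
  apply: K1 => t /andP[mt tX]; rewrite ler_wpM2l //.
  have t0 : 0 < t by exact: lt_le_trans mt.
  have := m2 t mt; rewrite /G; have /andP[w1 _] := WQ t t0.
  have : (Q t - W t) * nsq (u t) <= 0 by rewrite mulr_le0_ge0 ?nsq_ge0 // subr_le0.
  clear; lra.
have h1 : m0 + 1 <= m0 + 1 + (M + 1) by lra.
have h2 : r <= m0 + 1 by lra.
have := HM _ _ h2 h1.
have : int (fun=> 1) (m0 + 1) (m0 + 1 + (M + 1)) <= int (fun t => nsq (u t)) (m0 + 1) (m0 + 1 + (M + 1)).
  have m10 : 0 < m0 + 1 by lra.
  have [_ Pu _] := S _ _ m10 h1 (ltry _).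
  apply: int_le.
  - by apply: cont_L1; apply: continuous_subspaceT => ?; exact: cvg_cst.
  - exact: cont_L1 (prim_continuous (cprim_nsq Pu)).
  - move=> t /andP[mt _]; apply: le_trans (big t _); clear - mt; lra.
rewrite int_cst //; clear; lra.
Qed.

Lemma locally_L1_locL1 q : locally_L1 q -> locL1 +oo q.
Proof.
move=> qi x y x0 _; have y1 : 0 < `|y| + 1 by rewrite ltr_pwDr.
apply: (integrableS _ _ _ (qi _ y1)) => //.
apply: subset_itv; rewrite bnd_simp //.
by rewrite (le_lt_trans (ler_norm y)) // ltrDl.
Qed.

Lemma potential_locL1 q (e : right_end R) : potential_on q e -> locL1 (endpoint e) q.
Proof.
case: e => [c h| | |u0] /= => [[c0 qi]|[qi _]|[qi _ _]|[qi _ _ _ _]]; try exact: locally_L1_locL1.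
move=> x y x0; rewrite lte_fin => yc; apply: (integrableS _ _ _ qi) => //.
by apply: subset_itv; rewrite bnd_simp.
Qed.

Lemma weyl_flux_gt0 q (e : right_end R) z u : potential_on q e -> 0 < complex.Im z ->
  solution q (endpoint e) z u -> nonzero_on (endpoint e) u -> boundary_condition e u ->
  forall r, 0 < r -> (r%:E < endpoint e)%E -> 0 < flux u (cderive u) r.
Proof.
move=> pot z0 sl nz bc; have S := solution_solves (potential_locL1 pot) sl.
apply: contrapT => K; have [x [l]] := flux_neg_end S z0 nz K.
case: e pot sl nz bc S K => [c h| | |u0] /=.
- by move=> [c0 qi] _ _ bc S _; exact: no_neg_flux_regular qi S bc.
- by move=> [_ nq] _ _ bc S _; exact: no_neg_flux_bounded_below nq S bc.
- by move=> [_ _ LP] _ nz bc S _; exact: no_neg_flux_limit_point z0 LP S nz bc.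
- move=> [qi LC s0 nz0 cl0] _ nz bc S _.
  have S0 := solution_solves (locally_L1_locL1 qi) s0.
  exact: no_neg_flux_limit_circle z0 LC S nz S0 nz0 cl0 bc.
Qed.

(** A length on which [p] moves by at most |p x| / 4: the first summand comes from |u| <= (1 + 4
    exp(1 + Z + s)) t |p x| over a step [t]. The others keep the step below [delta / 4] and 1. *)
Definition m_step (delta s Z : R) : R :=
  (8 * (s + Z) * (1 + 4 * expR (1 + Z + s)) + 4 / delta + 1)^-1.

(** With [t] the step, the bound [t / 8] leaves |u| >= |p x| t / 8 on the second half of the step.
    The flux lost there is at least [zeta t^3 |p x|^2 / 128], twice what the second entry allows at
    [x]. *)
Definition m_eta (delta s Z zeta : R) : R :=
  Num.min (m_step delta s Z / 8) (zeta * m_step delta s Z ^+ 3 / 256).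

Lemma m_step_gt0 delta s Z : 0 < delta -> 0 <= s -> 0 <= Z -> 0 < m_step delta s Z.
Proof.
move=> d0 s0 Z0; rewrite invr_gt0 ltr_pwDr // addr_ge0 ?divr_ge0 ?(ltW d0) // mulr_ge0 ?addr_ge0 //.
by rewrite mulr_ge0 ?addr_ge0.
Qed.

Lemma m_eta_gt0 delta s Z zeta : 0 < delta -> 0 <= s -> 0 <= Z -> 0 < zeta ->
  0 < m_eta delta s Z zeta.
Proof.
move=> d0 s0 Z0 z0; have t0 := m_step_gt0 d0 s0 Z0.
rewrite /m_eta lt_min; apply/andP; split; first exact: divr_gt0.
exact: divr_gt0 (mulr_gt0 z0 (exprn_gt0 3 t0)) (ltr0n _ 256).
Qed.

(* If [u x] were too small against [p x], then [|u|] would grow like [|p x| (r - x) / 2] on an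
   interval of controlled length, and the flux lost there would exceed [|u x| |p x|]. *)
Lemma weyl_lower_u x q z u p (delta s Z zeta : R) : 0 < delta -> 0 <= s -> 0 < zeta ->
  normc z <= Z -> zeta <= complex.Im z ->
  sol x (x + m_step delta s Z) q z u p ->
  (forall r, x <= r <= x + m_step delta s Z -> 0 <= flux u p r) ->
  int (fun r => `|q r|) x (x + m_step delta s Z) <= s ->
  m_eta delta s Z zeta * normc (p x) <= normc (u x).
Proof.
move=> d0 s0 zeta0 zZ zim S pos Is.
have Z0 : 0 <= Z by exact: le_trans (normc_ge0 z) zZ.
have t0 := m_step_gt0 d0 s0 Z0; have eta0 := m_eta_gt0 d0 s0 Z0 zeta0.
have ht1 : m_eta delta s Z zeta <= m_step delta s Z / 8 by rewrite ge_min lexx.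
have ht2 : m_eta delta s Z zeta <= zeta * m_step delta s Z ^+ 3 / 256 by rewrite ge_min lexx orbT.
have hG : 8 * (s + Z) * (1 + 4 * expR (1 + Z + s)) * m_step delta s Z <= 1 /\ m_step delta s Z <= 1.
  rewrite /m_step; set A := 8 * _ * _; set B := 4 / delta.
  have A0 : 0 <= A by rewrite /A mulr_ge0 ?mulr_ge0 ?addr_ge0 // mulr_ge0 // expR_ge0.
  have B0 : 0 <= B by rewrite divr_ge0 // ltW.
  by split; [rewrite ler_pdivrMr | rewrite invf_le1]; clear - A0 B0; lra.
move: hG S pos Is t0 eta0 ht1 ht2.
set t := m_step delta s Z; set eta := m_eta delta s Z zeta; set Gm := expR _.
move=> [tG t1] S pos Is t0 eta0 ht1 ht2.
rewrite leNgt; apply/negP => small.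
have Gm1 : 1 <= Gm by rewrite -expR0 ler_expR !addr_ge0.
pose P := normc (p x).
have P0 : 0 < P.
  rewrite lt_neqAle normc_ge0 andbT eq_sym; apply/eqP => P0.
  by move: small; rewrite -/P P0 mulr0 ltNge normc_ge0.
have uP : normc (u x) <= eta * P by exact: ltW.
have eta1 : eta <= 1 by clear - ht1 t1 t0; lra.
have [qi Pu Pp] := S.
have bnd r : x <= r <= x + t -> normc (u r) <= 2 * Gm * P /\ normc (p r) <= 2 * Gm * P.
  move=> /andP[xr rt].
  have E := energy_fwd xr (sol_sub S (lexx x) rt).
  have : nsq (u r) + nsq (p r) <= (2 * Gm * P) ^+ 2.
    apply: le_trans E _.
    apply: (@le_trans _ _ (2 * P ^+ 2 * Gm)).
      have N0 : 0 <= nsq (u x) + nsq (p x) by have := nsq_ge0 (u x); have := nsq_ge0 (p x); clear; lra.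
      apply: ler_pM => //.
        have : nsq (u x) <= P ^+ 2.
          rewrite nsqE ler_pXn2r ?nnegrE ?normc_ge0 ?(ltW P0) // (le_trans uP) //.
          by rewrite ler_piMl // ltW.
        by rewrite [nsq (p x)]nsqE -/P; clear; lra.
      rewrite ler_expR int_add; first 1 last.
      - by apply: cont_L1; apply: continuous_subspaceT => ?; exact: cvg_cst.
      - exact: L1_norm (L1_sub qi (lexx x) rt).
      rewrite int_cst // lerD //.
        apply: (@le_trans _ _ ((1 + normc z) * 1)); last by clear - zZ; lra.
        by rewrite ler_wpM2l ?addr_ge0 ?normc_ge0 //; clear - rt t1; lra.
      apply: le_trans Is; apply: int_subset => //; exact: L1_norm.
    rewrite !exprMn; have : Gm <= Gm ^+ 2 by rewrite expr2 ler_peMl //; clear - Gm1; lra.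
    move=> g2; have : P ^+ 2 * Gm <= P ^+ 2 * Gm ^+ 2 by rewrite ler_wpM2l ?sqr_ge0.
    have : 0 <= P ^+ 2 * Gm ^+ 2 by rewrite mulr_ge0 ?sqr_ge0.
    clear; lra.
  have GP : 0 <= 2 * Gm * P by rewrite !mulr_ge0 // ?(ltW P0) //; clear - Gm1; lra.
  by rewrite !nsqE => h; split; rewrite -(@ler_pXn2r _ 2) ?nnegrE ?normc_ge0 //;
    have := sqr_ge0 (normc (u r)); have := sqr_ge0 (normc (p r)); clear - h; lra.
have cL (k a c : R) : L1 a c (fun=> k).
  by apply: cont_L1; apply: continuous_subspaceT => ?; exact: cvg_cst.
have ub r : x <= r <= x + t -> normc (u r) <= (1 + 4 * Gm) * t * P.
  move=> /andP[xr rt].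
  have := cprim_bound xr (cprim_sub Pu (lexx x) rt) (cL (2 * Gm * P) _ _).
  rewrite int_cst // => B.
  have {}B : normc (u r - u x) <= 2 * (2 * Gm * P * (r - x)).
    by apply: B => y /andP[xy yr]; apply: (bnd y _).2; rewrite xy (le_trans yr).
  have : 2 * Gm * P * (r - x) <= 2 * Gm * P * t.
    by rewrite ler_wpM2l // ?mulr_ge0 ?(ltW P0) //; clear - rt Gm1; lra.
  have := le_normcD (u x) (u r - u x); rewrite addrC subrK.
  have : eta * P <= t * P by rewrite ler_wpM2r ?(ltW P0) //; clear - ht1 t0; lra.
  clear - B uP; lra.
have pb r : x <= r <= x + t -> normc (p r - p x) <= P / 4.
  move=> /andP[xr rt].
  have qr := L1_sub qi (lexx x) rt.
  have Lq : L1 x r (fun y => (1 + 4 * Gm) * t * P * (`|q y| + Z)).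
    by apply: L1_scale; apply: L1_add => //; exact: L1_norm.
  have := cprim_bound xr (cprim_sub Pp (lexx x) rt) Lq.
  rewrite int_scale; last by apply: L1_add => //; exact: L1_norm.
  rewrite int_add //; last exact: L1_norm.
  rewrite int_cst // => B.
  apply: le_trans (B _) _.
    move=> y /andP[xy yr]; rewrite normcM mulrC; apply: ler_pM; rewrite ?normc_ge0 //.
      by apply: ub; rewrite xy (le_trans yr).
    by apply: le_trans (le_normcD _ _) _; rewrite normc_real normcN lerD2l.
  have I1 : int (fun y => `|q y|) x r <= s.
    by apply: le_trans Is; apply: int_subset => //; exact: L1_norm.
  have I2 : Z * (r - x) <= Z by rewrite ler_piMr //; clear - rt t1; lra.
  have c0 : 0 <= (1 + 4 * Gm) * t * P by rewrite !mulr_ge0 ?(ltW t0) ?(ltW P0) //; clear - Gm1; lra.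
  have := ler_wpM2l c0 (lerD I1 I2).
  have : 8 * (s + Z) * (1 + 4 * Gm) * t * P <= 1 * P by rewrite ler_wpM2r // ltW.
  clear; lra.
have lower r : x + t / 2 <= r <= x + t -> P * t / 8 <= normc (u r).
  move=> /andP[xr rt]; have xr' : x <= r by clear - xr t0; lra.
  have Plin : cprim x r (fun y => u y - p x * y%:C) (fun y => p y - p x).
    apply: cprim_ext (cprim_subf (cprim_sub Pu (lexx x) rt) (cprim_scale (p x) (cprim_real (prim_id x r)))) _ _ => // y _.
    by rewrite mulr1.
  have := cprim_bound xr' Plin (cL (P / 4) _ _); rewrite int_cst // => B.
  have {}B : normc (u r - p x * r%:C - (u x - p x * x%:C)) <= 2 * (P / 4 * (r - x)).
    by apply: B => y /andP[xy yr]; apply: pb; rewrite xy (le_trans yr).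
  have := ler_normcB (p x * (r - x)%:C) (u x + (u r - p x * r%:C - (u x - p x * x%:C))).
  have -> : p x * (r - x)%:C + (u x + (u r - p x * r%:C - (u x - p x * x%:C))) = u r.
    by rewrite rmorphB /=; ring.
  rewrite normcM normc_real -/P ger0_norm; last by clear - xr'; lra.
  have := le_normcD (u x) (u r - p x * r%:C - (u x - p x * x%:C)).
  have : P * (t / 2) <= P * (r - x) by rewrite ler_wpM2l ?(ltW P0) //; clear - xr; lra.
  have : eta * P <= t / 8 * P by rewrite ler_wpM2r ?(ltW P0).
  clear - B uP; lra.
have xt2 : x <= x + t / 2 by clear - t0; lra.
have xt : x + t / 2 <= x + t by clear - t0; lra.
have PF := lagrange S.
have F1 : flux u p (x + t / 2) <= flux u p x.
  have := prim_le xt2 (prim_sub PF (lexx x) xt) (prim_cst x (x + t / 2) 0).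
  rewrite [0 - 0]subr0 subr_le0; apply => r _.
  by rewrite mulNr oppr_le0 mulr_ge0 ?nsq_ge0 //; clear - zeta0 zim; lra.
have F2 : flux u p (x + t) - flux u p (x + t / 2) <= - (zeta * (P * t / 8) ^+ 2) * (t / 2).
  have := prim_le xt (prim_sub PF xt2 (lexx _)) (prim_scale (- (zeta * (P * t / 8) ^+ 2)) (prim_id _ _)).
  rewrite -mulrBr /= => K; apply: le_trans (K _) _; last first.
    by rewrite le_eqVlt; apply/orP; left; apply/eqP; congr (_ * _); field.
  move=> r rr; rewrite mulr1 mulNr lerN2 nsqE; apply: ler_pM => //.
  - exact: ltW.
  - exact: sqr_ge0.
  - by rewrite ler_pXn2r ?nnegrE ?normc_ge0 ?lower // !mulr_ge0 ?(ltW P0) ?(ltW t0).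
have F3 : 0 <= flux u p (x + t) by apply: pos; clear - t0; lra.
have F4 : flux u p x <= eta * P * P.
  apply: le_trans (Im_le_normc _) _; rewrite normcM normc_conj -/P ler_wpM2r //; exact: ltW.
have PP : 0 < P ^+ 2 by exact: exprn_gt0.
have zt : 0 < zeta * t ^+ 3 by rewrite mulr_gt0 ?exprn_gt0.
have : eta * P ^+ 2 <= zeta * t ^+ 3 / 256 * P ^+ 2 by rewrite ler_wpM2r ?sqr_ge0.
have : 0 < zeta * t ^+ 3 * P ^+ 2 by rewrite mulr_gt0.
clear - F1 F2 F3 F4; lra.
Qed.

End WeylMFunction.

(** * Estimates on the m-functions *)

Section MFunctionDecay.
Variable R : realType.
Implicit Types (f g F G q : R -> R) (x y s t r : R) (u v w p U V : R -> R[i]) (z k : R[i]).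
Implicit Types (b : \bar R) (e : right_end R).

Local Notation mu := (@lebesgue_measure R).

Lemma clim_mul (F : set_system R) (FF : ProperFilter F) U V (l m : R[i]) :
  clim F U l -> clim F V m -> clim F (fun x => U x * V x) (l * m).
Proof.
move=> [u1 u2] [v1 v2]; split.
- have -> : (fun x => complex.Re (U x * V x)) =
      (fun x => complex.Re (U x) * complex.Re (V x) - complex.Im (U x) * complex.Im (V x)).
    by apply/funext => x; case: (U x) (V x) => ? ? [? ?].
  have -> : complex.Re (l * m) = complex.Re l * complex.Re m - complex.Im l * complex.Im m.
    by case: (l) (m) => ? ? [? ?].
  by apply: cvgB; apply: cvgM.
- have -> : (fun x => complex.Im (U x * V x)) =
      (fun x => complex.Re (U x) * complex.Im (V x) + complex.Im (U x) * complex.Re (V x)).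
    by apply/funext => x; case: (U x) (V x) => ? ? [? ?].
  have -> : complex.Im (l * m) = complex.Re l * complex.Im m + complex.Im l * complex.Re m.
    by case: (l) (m) => ? ? [? ?].
  by apply: cvgD; apply: cvgM.
Qed.

Lemma clim_sub (F : set_system R) (FF : ProperFilter F) U V (l m : R[i]) :
  clim F U l -> clim F V m -> clim F (fun x => U x - V x) (l - m).
Proof.
move=> [u1 u2] [v1 v2]; split.
- have -> : (fun x => complex.Re (U x - V x)) = (fun x => complex.Re (U x) - complex.Re (V x)).
    by apply/funext => x; rewrite ReB.
  by rewrite ReB; apply: cvgB.
- have -> : (fun x => complex.Im (U x - V x)) = (fun x => complex.Im (U x) - complex.Im (V x)).
    by apply/funext => x; rewrite ImB.
  by rewrite ImB; apply: cvgB.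
Qed.

Lemma clim_normc (F : set_system R) (FF : ProperFilter F) U (l : R[i]) :
  clim F U l -> normc (U x) @[x --> F] --> normc l.
Proof.
move=> cU; apply/cvgrPdist_lt => e e0; have : \forall x \near F, normc (U x - l) < e by exact: clim_near cU e0.
apply: filterS => x; apply: le_lt_trans.
have h1 := le_normcD (U x - l) l; rewrite subrK in h1.
have h2 := ler_normcB l (U x - l); rewrite [l + _]addrC subrK in h2.
by rewrite ler_norml; apply/andP; split; lra.
Qed.

Lemma Rintegral_norm_subset (A B : set R) q : measurable A -> measurable B ->
  mu.-integrable B (EFin \o q) -> A `<=` B ->
  \int[mu]_(t in A) `|q t| <= \int[mu]_(t in B) `|q t|.
Proof.
move=> mA mB /integrable_norm qi AB.
have [mq _] := integrableP _ _ _ qi.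
have fB : (\int[mu]_(t in B) (`|q t|)%:E)%E \is a fin_num by exact: integrable_fin_num qi.
have sub : (\int[mu]_(t in A) (`|q t|)%:E <= \int[mu]_(t in B) (`|q t|)%:E)%E.
  exact: ge0_subset_integral.
apply: fine_le => //.
rewrite ge0_fin_numE; last exact: integral_ge0.
by apply: le_lt_trans sub _; rewrite -ge0_fin_numE //; exact: integral_ge0.
Qed.

Lemma potential_integrable q e (c : R) : potential_on q e -> 0 < c -> (c%:E <= endpoint e)%E ->
  mu.-integrable `]0, c[ (EFin \o q).
Proof.
move=> pot c0 ce; case: e pot ce => [d h| | |u0] /=.
- move=> [_ qi]; rewrite lee_fin => cd; apply: (integrableS _ _ _ qi) => //.
  by apply: subset_itv; rewrite bnd_simp.
- by move=> [qi _] _; exact: qi.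
- by move=> [qi _ _] _; exact: qi.
- by move=> [qi _ _ _ _] _; exact: qi.
Qed.

Let at0 : ProperFilter (0 : R)^'+ := at_right_proper_filter (0 : R).

(** * Integrals of |q| against the supremum over windows *)

Section LocalSup.
Variables (q : R -> R) (a delta : R).
Hypotheses (a0 : 0 < a) (delta0 : 0 < delta) (qi : mu.-integrable `]0, (a + delta)[ (EFin \o q)).

Let s := sup_local_L1 q a delta.

Lemma sup_local_L1_ge x : 0 <= x <= a -> \int[mu]_(y in `]x, (x + delta)[) `|q y| <= s.
Proof using a0 delta0 qi.
have ha := a0; have hd := delta0.
move=> xa; apply: ub_le_sup; last by exists x => //=; rewrite in_itv.
(* Boundedness above is what makes [sup] a true supremum rather than a default value; every window
   lies in []0, a + delta[]. *)
exists (\int[mu]_(y in `]0, (a + delta)[) `|q y|) => v [y + <-]; rewrite /= in_itv /= => /andP[y0 ya].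
apply: Rintegral_norm_subset => //.
by apply: subset_itv; rewrite bnd_simp //; lra.
Qed.

Lemma sup_local_L1_ge0 : 0 <= s.
Proof using a0 delta0 qi.
apply: le_trans (@sup_local_L1_ge 0 _); last by rewrite lexx ltW.
exact: Rintegral_ge0.
Qed.

Lemma int_le_window x' x y : 0 <= x' <= a -> x' < x -> y < x' + delta ->
  int (fun t => `|q t|) x y <= s.
Proof using a0 delta0 qi.
have ha := a0; have hd := delta0.
move=> xa h1 h2; apply: le_trans (sup_local_L1_ge xa); apply: Rintegral_norm_subset => //.
- apply: (integrableS _ _ _ qi) => //.
  by apply: subset_itv; rewrite bnd_simp //; lra.
- by apply: subset_itv; rewrite bnd_simp.
Qed.

Lemma int_le_half_window x : 0 < x -> x <= a -> int (fun t => `|q t|) x (x + delta / 2) <= s.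
Proof using a0 delta0 qi.
have ha := a0; have hd := delta0.
(* The closed interval has to fit strictly inside an open window of length [delta] starting in
   [[0, a]]: start at 0 if [x] is small, else [delta / 4] before [x]. *)
move=> x0 xa; have [h|h] := leP x (delta / 4).
  by apply: (@int_le_window 0); lra.
by apply: (@int_le_window (x - delta / 4)); lra.
Qed.

(** Covering by half windows: the dependence on [a] is confined to the count [n], which ends up in
    the threshold and not in the high-energy constant. *)
Lemma int_le_chain n x y : 0 < x -> x <= y -> y <= a -> y - x <= n%:R * (delta / 2) ->
  int (fun t => `|q t|) x y <= n%:R * s.
Proof using a0 delta0 qi.
have ha := a0; have hd := delta0.
have qc x1 y1 : 0 < x1 -> y1 <= a -> L1 x1 y1 (fun t => `|q t|).
  move=> h1 h2; apply: L1_norm; apply: (integrableS _ _ _ qi) => //.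
  by apply: subset_itv; rewrite bnd_simp //; lra.
elim: n x => [|n IH] x x0 xy ya.
  rewrite !mul0r => yx; have -> : x = y by lra.
  by rewrite int_point.
rewrite -natr1 !mulrDl !mul1r => h.
have s0 := sup_local_L1_ge0.
have [yd|dy] := leP y (x + delta / 2).
  apply: (@le_trans _ _ s); last by rewrite lerDr mulr_ge0.
  have [hx|hx] := leP x (delta / 4).
    by apply: (@int_le_window 0); lra.
  by apply: (@int_le_window (x - delta / 4)); lra.
have xm : x <= x + delta / 2 by lra.
rewrite (int_cat (qc x y x0 ya) xm (ltW dy)) addrC; apply: lerD.
- by apply: IH; lra.
- by apply: int_le_half_window => //; lra.
Qed.

End LocalSup.

(** In the sector both [cos theta] and [- sin theta] exceed [sin eps], which becomes the [sigma] of
    all estimates. *)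
Lemma sector_bounds (eps : R) k : 0 < eps -> in_sector eps k ->
  [/\ 0 < sin eps, 0 < normc k, sin eps * normc k <= - complex.Im k
    & sin eps * normc k <= complex.Re k].
Proof.
move=> e0 [th [k0 _ kE] /andP[h1 h2]].
have e4 : eps < pi / 2 by lra.
have se : 0 < sin eps by apply: sin_gt0_pihalf; rewrite e0.
have n0 := normc_gt0 k0.
have ein : eps \in `[- (pi / 2), pi / 2] by rewrite in_itv /=; apply/andP; split; lra.
have s1 : sin eps < - sin th.
  by rewrite -sinN ltr_sin //; [lra | rewrite in_itv /=; apply/andP; split; lra].
have s2 : sin eps < cos th.
  by rewrite -sinDpihalf ltr_sin //; [lra | rewrite in_itv /=; apply/andP; split; lra].
rewrite normr_normc in kE.
have E1 : complex.Re k = normc k * cos th by rewrite {1}kE /=; ring.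
have E2 : complex.Im k = normc k * sin th by rewrite {1}kE /=; ring.
split=> //; rewrite ?E1 ?E2 mulrC -?mulrN; apply: ler_wpM2l => //; exact: ltW.
Qed.

(** What the estimates take from a Weyl solution, in a form common to the four kinds of right
    end. *)
Record weyl_solution (a delta : R) q k u p (c0 c1 : R[i]) : Prop := {
  ws_sol : forall x y, 0 < x -> x <= y -> y < a + delta -> sol x y q (- k ^+ 2) u p;
  ws_flux : forall r, 0 < r -> r < a + delta -> 0 < flux u p r;
  ws_flux_ge : forall r, 0 < r -> r <= a -> flux u p a <= flux u p r;
  ws_lim0 : clim 0^'+ u c0;
  ws_lim1 : clim 0^'+ p c1 }.

Lemma Im_spectral k (sigma : R) : 0 < sigma -> 0 < normc k -> sigma * normc k <= - complex.Im k ->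
  sigma * normc k <= complex.Re k -> 2 * sigma ^+ 2 * normc k ^+ 2 <= complex.Im (- k ^+ 2).
Proof.
move=> s0 n0 h1 h2.
have -> : complex.Im (- k ^+ 2) = 2 * (complex.Re k * - complex.Im k).
  by case: (k) => ? ? /=; ring.
rewrite -mulrA ler_wpM2l // -exprMn expr2; apply: ler_pM => //; rewrite mulr_ge0 ?ltW //.
Qed.

Lemma m_function_weyl_solution (a delta : R) q e m k : 0 < a -> 0 < delta -> potential_on q e ->
  (a%:E < endpoint e)%E -> ((a + delta)%:E <= endpoint e)%E -> m_function q e m ->
  0 < complex.Im (- k ^+ 2) ->
  exists u p c0 c1, weyl_solution a delta q k u p c0 c1 /\ m (- k ^+ 2) = c1 / c0.
Proof.
move=> a0 d0 pot ae ade mf z0; have [u [c0 [c1 [sl nz bc [l0 l1] mE]]]] := mf _ z0.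
exists u, (cderive u), c0, c1; split=> //.
have S := solution_solves (potential_locL1 pot) sl.
have lt_end r : r < a + delta -> (r%:E < endpoint e)%E.
  by move=> h; apply: lt_le_trans ade; rewrite lte_fin.
split=> //.
- by move=> x y x0 xy yb; apply: S => //; exact: lt_end.
- by move=> r r0 rb; apply: (weyl_flux_gt0 pot z0 sl nz bc) => //; exact: lt_end.
- by move=> r r0 ra; apply: (flux_le S) => //; exact: ltW.
Qed.

Section WeylSolution.
Variables (a delta sigma : R) (q : R -> R) (k : R[i]) (u p : R -> R[i]) (c0 c1 : R[i]).
Hypotheses (a0 : 0 < a) (delta0 : 0 < delta) (sigma0 : 0 < sigma)
  (qi : mu.-integrable `]0, (a + delta)[ (EFin \o q))
  (ws : weyl_solution a delta q k u p c0 c1)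
  (k0 : 0 < normc k) (Imk : sigma * normc k <= - complex.Im k)
  (Rek : sigma * normc k <= complex.Re k).

Let s := sup_local_L1 q a delta.

(** If [u] tended to 0 at 0, so would [u p], since [p] has a limit; but the flux near 0 is at least
    its positive value at [a]. Hence [c1 / c0] is a genuine quotient. *)
Lemma weyl_lim_neq0 : c0 != 0.
Proof using a0 delta0 ws.
apply/eqP => E; have := clim_normc at0 (clim_mul at0 (ws_lim0 ws) (ws_lim1 ws)).
rewrite E mul0r normc0 => cv.
have fa : 0 < flux u p a by apply: (ws_flux ws) => //; rewrite ltrDl.
suff : flux u p a <= 0 by rewrite leNgt fa.
apply: (cvgr_to_ge cv); near=> r.
have r0 : 0 < r by near: r; exact: nbhs_right_gt.
have ra : r <= a by near: r; exact: nbhs_right_ltW.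
apply: le_trans (ws_flux_ge ws r0 ra) _.
by apply: le_trans (Im_le_normc _) _; rewrite !normcM normc_conj.
Unshelve. all: by end_near. Qed.

Lemma weyl_ratio_decay x : 0 < x -> x <= a -> s <= sigma * normc k ->
  normc (k * u x + p x) * normc k <= Omega delta sigma s * normc (k * u x - p x).
Proof using a0 delta0 sigma0 qi ws k0 Imk Rek.
have ha := a0; have hd := delta0.
move=> x0 xa sk.
have xd : x <= x + delta / 2 by lra.
have xb : x + delta / 2 < a + delta by lra.
apply: (ratio_decay delta0 (ws_sol ws x0 xd xb)) => //.
  by move=> r /andP[xr rx]; apply/ltW/(ws_flux ws); lra.
exact: int_le_half_window.
Qed.

(** The [+ 1] is the share of the potential in the Gronwall exponent, at most
    [n s / (sigma |k|)]. *)
Lemma weyl_decay (n : nat) x : 0 < x -> x <= a -> a <= n%:R * (delta / 2) ->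
  n%:R * s <= sigma * normc k ->
  normc (k * u a - p a) <= normc (k * u x - p x) * expR (- (a - x) * complex.Re k + 1).
Proof using a0 delta0 sigma0 qi ws k0 Imk.
have ha := a0; have hd := delta0.
move=> x0 xa an ns; have ab : a < a + delta by rewrite ltrDl.
have fl r : x <= r <= a -> 0 <= complex.Im ((u r)^* * p r).
  by move=> /andP[xr ra]; apply/ltW/(ws_flux ws); lra.
apply: le_trans (decay xa (ws_sol ws x0 xa ab) fl sigma0 k0 Imk) _.
rewrite ler_wpM2l ?normc_ge0 // ler_expR lerD2l ler_pdivrMr ?mulr_gt0 // mul1r.
apply: le_trans ns; apply: int_le_chain => //; lra.
Qed.

Lemma weyl_m_bound (Z zeta : R) : normc (- k ^+ 2) <= Z -> 0 < zeta -> zeta <= complex.Im (- k ^+ 2) ->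
  normc (c1 / c0) <= (m_eta delta s Z zeta)^-1.
Proof using a0 delta0 qi ws.
have ha := a0; have hd := delta0.
move=> zZ z0 zi.
have s0 : 0 <= s by exact: sup_local_L1_ge0.
have Z0 : 0 <= Z by exact: le_trans (normc_ge0 _) zZ.
have eta0 := m_eta_gt0 delta0 s0 Z0 z0.
have c00 := normc_gt0 weyl_lim_neq0.
rewrite normcM normcV ler_pdivrMr // ler_pdivlMl //.
have cl0 := clim_normc at0 (ws_lim0 ws).
have cl1 : (m_eta delta s Z zeta * normc (p x)) @[x --> 0^'+] --> m_eta delta s Z zeta * normc c1.
  have cp := clim_normc at0 (ws_lim1 ws).
  by apply: cvgM cp; exact: cvg_cst.
apply: (ler_cvg_to cl1 cl0); near=> x.
have x0 : 0 < x by near: x; exact: nbhs_right_gt.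
have xd : x < delta / 4 by near: x; apply: nbhs_right_lt; lra.
have st : m_step delta s Z <= delta / 4.
  rewrite /m_step; set A := 8 * _ * _.
  have A0 : 0 <= A by rewrite /A mulr_ge0 ?mulr_ge0 ?addr_ge0 // mulr_ge0 // expR_ge0.
  have d4 : 0 < 4 / delta by exact: divr_gt0.
  rewrite -[delta / 4]invrK invf_div lef_pV2 ?posrE //; lra.
have st0 := m_step_gt0 delta0 s0 Z0.
have xt : x <= x + m_step delta s Z by lra.
have tb : x + m_step delta s Z < a + delta by lra.
apply: (weyl_lower_u delta0 s0 z0 zZ zi (ws_sol ws x0 xt tb)).
  move=> r /andP[xr rx]; apply/ltW/(ws_flux ws); first exact: lt_le_trans xr.
  exact: le_lt_trans rx tb.
apply: (int_le_window a0 delta0 qi (x' := 0)) => //; first by rewrite lexx ltW.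
by rewrite add0r; apply: lt_le_trans (ltr_leD xd st) _; lra.
Unshelve. all: by end_near. Qed.

End WeylSolution.

Lemma Omega_ge0 (delta sigma s : R) : 0 < delta -> 0 < sigma -> 0 <= s -> 0 <= Omega delta sigma s.
Proof.
move=> d0 g0 s0; rewrite /Omega mulr_ge0 ?expR_ge0 // addr_ge0 //.
  by rewrite divr_ge0 ?mulr_ge0 ?addr_ge0 ?divr_ge0 // ltW.
by rewrite divr_ge0 ?mulr_ge0 // ltW.
Qed.

(** The equation lives on the open interval, so the Wronskian is estimated at [x > 0] and the
    inequality is passed to the limit [x -> 0+], where the Wronskian over [c01 c02] is [m2 - m1]. *)
Lemma m_difference_bound (a delta sigma : R) q1 q2 k u1 p1 u2 p2 (c01 c11 c02 c12 : R[i]) (n : nat) :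
  0 < a -> 0 < delta -> 0 < sigma ->
  mu.-integrable `]0, (a + delta)[ (EFin \o q1) -> mu.-integrable `]0, (a + delta)[ (EFin \o q2) ->
  weyl_solution a delta q1 k u1 p1 c01 c11 -> weyl_solution a delta q2 k u2 p2 c02 c12 ->
  {ae mu, forall x, 0 <= x <= a -> q1 x = q2 x} ->
  0 < normc k -> sigma * normc k <= - complex.Im k -> sigma * normc k <= complex.Re k ->
  a <= n%:R * (delta / 2) ->
  forall s1 s2, s1 = sup_local_L1 q1 a delta -> s2 = sup_local_L1 q2 a delta ->
  n%:R * s1 <= sigma * normc k -> n%:R * s2 <= sigma * normc k ->
  s1 <= sigma * normc k -> s2 <= sigma * normc k ->
  2 * Omega delta sigma s1 <= normc k -> 2 * Omega delta sigma s2 <= normc k ->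
  normc (c11 / c01 - c12 / c02) <=
    8 * (Omega delta sigma s1 + Omega delta sigma s2) * expR 2 * expR (- 2 * a * complex.Re k).
Proof.
move=> a0 d0 g0 qi1 qi2 w1 w2 ae k0 Imk Rek an s1 s2 E1 E2 ns1 ns2 sk1 sk2 O1 O2.
have n1 := weyl_lim_neq0 a0 d0 w1; have n2 := weyl_lim_neq0 a0 d0 w2.
have p1' := normc_gt0 n1; have p2' := normc_gt0 n2.
have s10 : 0 <= s1 by rewrite E1; exact: sup_local_L1_ge0.
have s20 : 0 <= s2 by rewrite E2; exact: sup_local_L1_ge0.
have ab : a < a + delta by rewrite ltrDl.
set B := 8 * _ * _.
have -> : c11 / c01 - c12 / c02 = - (c01 * c12 - c11 * c02) / (c01 * c02).
  by field; rewrite n1 n2.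
rewrite normcM normcN normcV normcM ler_pdivrMr ?mulr_gt0 //.
have clW := clim_normc at0 (clim_sub at0 (clim_mul at0 (ws_lim0 w1) (ws_lim1 w2)) (clim_mul at0 (ws_lim1 w1) (ws_lim0 w2))).
have cR : (B * expR (- (2 * (a - x)) * complex.Re k) * (normc (u1 x) * normc (u2 x))) @[x --> 0^'+] -->
    B * expR (- 2 * a * complex.Re k) * (normc c01 * normc c02).
  apply: cvgM; last exact: cvgM (clim_normc at0 (ws_lim0 w1)) (clim_normc at0 (ws_lim0 w2)).
  apply: cvgM; first exact: cvg_cst.
  have -> : - 2 * a * complex.Re k = - (2 * (a - 0)) * complex.Re k by ring.
  have c : {for (0 : R), continuous (fun x => expR (- (2 * (a - x)) * complex.Re k))}.
    apply: continuous_comp; last exact: continuous_expR.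
    apply: cvgM; last exact: cvg_cst.
    apply: cvgN; apply: cvgM; first exact: cvg_cst.
    apply: cvgB; [exact: cvg_cst | exact: cvg_id].
  exact: cvg_at_right_filter c.
apply: (ler_cvg_to clW cR); near=> x.
have x0 : 0 < x by near: x; exact: nbhs_right_gt.
have xa : x <= a by near: x; exact: nbhs_right_ltW.
have Wc : u1 a * p2 a - p1 a * u2 a = u1 x * p2 x - p1 x * u2 x.
  apply: (wronskian_const xa (ws_sol w1 x0 xa ab) (ws_sol w2 x0 xa ab)).
  by apply: aeS ae => t H /andP[xt ta]; apply: H; rewrite ta andbT (le_trans (ltW x0)).
apply: (wronskian_decay k0 Wc) => //.
- by rewrite E1; apply: (weyl_ratio_decay a0 d0 g0 qi1 w1 k0 Imk Rek a0 (lexx a)); rewrite -E1.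
- by rewrite E2; apply: (weyl_ratio_decay a0 d0 g0 qi2 w2 k0 Imk Rek a0 (lexx a)); rewrite -E2.
- by rewrite E1; apply: (weyl_ratio_decay a0 d0 g0 qi1 w1 k0 Imk Rek x0 xa); rewrite -E1.
- by rewrite E2; apply: (weyl_ratio_decay a0 d0 g0 qi2 w2 k0 Imk Rek x0 xa); rewrite -E2.
- exact: Omega_ge0.
- exact: Omega_ge0.
- by apply: (weyl_decay a0 d0 g0 qi1 w1 k0 Imk x0 xa an); rewrite -E1.
- by apply: (weyl_decay a0 d0 g0 qi2 w2 k0 Imk x0 xa an); rewrite -E2.
Unshelve. all: by end_near. Qed.

(** All summands are nonnegative, so |k| dominates each: in turn they give [n s_j <= sigma |k|] for
    a number [n] of half windows covering [[0, a]], then [s_j <= sigma |k|], then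
    [2 Omega <= |k|]. *)
Definition threshold (a eps delta s1 s2 : R) : R :=
  Num.max 1 ((Num.bound (2 * a / delta))%:R * (s1 + s2) / sin eps + (s1 + s2) / sin eps
    + 2 * Omega delta (sin eps) s1 + 2 * Omega delta (sin eps) s2).

Definition decay_constant (eps delta s1 s2 : R) : R :=
  8 * (Omega delta (sin eps) s1 + Omega delta (sin eps) s2) * expR 2.

(** For [K0 <= |k| <= K] in the sector, [K ^+ 2] bounds |k^2| and [2 * sin eps ^+ 2 * K0 ^+ 2]
    bounds [Im (- k^2)] from below. *)
Definition small_energy_bound (K K0 eps delta s : R) : R :=
  (m_eta delta s (K ^+ 2) (2 * sin eps ^+ 2 * K0 ^+ 2))^-1.

Definition low_constant (a K0 eps delta s1 s2 : R) : R :=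
  let K := threshold a eps delta s1 s2 in
  decay_constant eps delta s1 s2 +
  (small_energy_bound K K0 eps delta s1 + small_energy_bound K K0 eps delta s2) * expR (2 * a * K).

Lemma m_difference_high (a eps delta : R) q1 q2 e1 e2 (m1 m2 : R[i] -> R[i]) k :
  0 < a -> 0 < eps -> 0 < delta -> potential_on q1 e1 -> potential_on q2 e2 ->
  (a%:E < endpoint e1)%E -> (a%:E < endpoint e2)%E ->
  ((a + delta)%:E <= endpoint e1)%E -> ((a + delta)%:E <= endpoint e2)%E ->
  m_function q1 e1 m1 -> m_function q2 e2 m2 ->
  {ae mu, forall x, 0 <= x <= a -> q1 x = q2 x} ->
  in_sector eps k ->
  forall s1 s2, s1 = sup_local_L1 q1 a delta -> s2 = sup_local_L1 q2 a delta ->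
  threshold a eps delta s1 s2 <= normc k ->
  normc (m1 (- k ^+ 2) - m2 (- k ^+ 2)) <=
    decay_constant eps delta s1 s2 * expR (- 2 * a * complex.Re k).
Proof.
move=> a0 eps0 d0 pot1 pot2 ae1 ae2 ad1 ad2 mf1 mf2 ae sec s1 s2 E1 E2 hK.
have [g0 k0 Imk Rek] := sector_bounds eps0 sec.
have ad : 0 < a + delta by exact: addr_gt0.
have qi1 := potential_integrable pot1 ad ad1; have qi2 := potential_integrable pot2 ad ad2.
have s10 : 0 <= s1 by rewrite E1; exact: sup_local_L1_ge0.
have s20 : 0 <= s2 by rewrite E2; exact: sup_local_L1_ge0.
have z0 : 0 < complex.Im (- k ^+ 2).
  apply: lt_le_trans (Im_spectral g0 k0 Imk Rek).
  by rewrite !mulr_gt0 ?exprn_gt0.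
have [u1 [p1 [c01 [c11 [w1 ->]]]]] := m_function_weyl_solution a0 d0 pot1 ae1 ad1 mf1 z0.
have [u2 [p2 [c02 [c12 [w2 ->]]]]] := m_function_weyl_solution a0 d0 pot2 ae2 ad2 mf2 z0.
move: hK; rewrite /threshold ge_max => /andP[_].
set n := Num.bound _; set sg := sin eps in g0 Imk Rek *.
have O10 := Omega_ge0 d0 g0 s10; have O20 := Omega_ge0 d0 g0 s20.
have A0 : 0 <= n%:R * (s1 + s2) / sg by rewrite divr_ge0 ?mulr_ge0 ?addr_ge0 // ltW.
have B0 : 0 <= (s1 + s2) / sg by rewrite divr_ge0 ?addr_ge0 // ltW.
move=> hK.
have an : a <= n%:R * (delta / 2).
  have : 2 * a / delta < n%:R.
    by apply: archi_boundP; rewrite divr_ge0 ?mulr_ge0 // ltW.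
  rewrite ltr_pdivrMr // => h; lra.
have hA : n%:R * (s1 + s2) <= sg * normc k.
  by rewrite mulrC -ler_pdivrMl // mulrC; lra.
have hB : s1 + s2 <= sg * normc k.
  by rewrite mulrC -ler_pdivrMr //; lra.
have n1 : 0 <= n%:R * s1 by rewrite mulr_ge0.
have n2 : 0 <= n%:R * s2 by rewrite mulr_ge0.
by apply: (m_difference_bound a0 d0 g0 qi1 qi2 w1 w2 ae k0 Imk Rek an E1 E2);
  clear - n1 n2 s10 s20 O10 O20 A0 B0 hA hB hK; lra.
Qed.

Lemma m_function_low (a eps delta K K0 : R) q e (m : R[i] -> R[i]) k :
  0 < a -> 0 < eps -> 0 < delta -> potential_on q e ->
  (a%:E < endpoint e)%E -> ((a + delta)%:E <= endpoint e)%E -> m_function q e m ->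
  in_sector eps k -> 0 < K0 -> K0 <= normc k -> normc k <= K ->
  normc (m (- k ^+ 2)) <= small_energy_bound K K0 eps delta (sup_local_L1 q a delta).
Proof.
move=> a0 eps0 d0 pot ae ad mf sec K00 kK0 kK.
have [g0 k0 Imk Rek] := sector_bounds eps0 sec.
have ad0 : 0 < a + delta by exact: addr_gt0.
have qi := potential_integrable pot ad0 ad.
have zz := Im_spectral g0 k0 Imk Rek.
have zeta0 : 0 < 2 * sin eps ^+ 2 * K0 ^+ 2 by rewrite !mulr_gt0 ?exprn_gt0.
have zeta1 : 2 * sin eps ^+ 2 * K0 ^+ 2 <= complex.Im (- k ^+ 2).
  apply: le_trans zz; apply: ler_wpM2l; first exact: mulr_ge0 (ler0n _ 2) (sqr_ge0 _).
  by rewrite ler_pXn2r ?nnegrE ?(ltW K00) ?normc_ge0.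
have z0 := lt_le_trans zeta0 zeta1.
have [u [p [c0 [c1 [w ->]]]]] := m_function_weyl_solution a0 d0 pot ae ad mf z0.
apply: (weyl_m_bound a0 d0 qi w) => //.
rewrite normcN expr2 normcM -expr2 ler_pXn2r ?nnegrE ?normc_ge0 //.
exact: le_trans (normc_ge0 k) kK.
Qed.

End MFunctionDecay.


Theorem theorem1p3 (R : realType) :
  exists (C : R -> R -> R -> R -> R)
         (K : R -> R -> R -> R -> R -> R)
         (C' : R -> R -> R -> R -> R -> R -> R),
  forall (a eps delta : R) (q1 q2 : R -> R) (e1 e2 : right_end R)
         (m1 m2 : R[i] -> R[i]),
  0 < a -> 0 < eps -> 0 < delta ->
  potential_on q1 e1 -> potential_on q2 e2 ->
  (a%:E < endpoint e1)%E -> (a%:E < endpoint e2)%E ->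
  ((a + delta)%:E <= endpoint e1)%E -> ((a + delta)%:E <= endpoint e2)%E ->
  m_function q1 e1 m1 -> m_function q2 e2 m2 ->
  {ae (@lebesgue_measure R), forall x : R, 0 <= x <= a -> q1 x = q2 x} ->
  let s1 := sup_local_L1 q1 a delta in
  let s2 := sup_local_L1 q2 a delta in
  (* the constant depends on eps, delta, s1, s2 only; the threshold K on these and a *)
  (0 < K a eps delta s1 s2 /\
   forall k : R[i], in_sector eps k -> (K a eps delta s1 s2)%:C <= `|k| ->
     `|m1 (- k ^+ 2) - m2 (- k ^+ 2)|
       <= (C eps delta s1 s2 * expR (- 2 * a * complex.Re k))%:C) /\
  (* any threshold K0; the constant depends on the fixed parameters a, K0 as well *)
  (forall K0 : R, 0 < K0 ->
   forall k : R[i], in_sector eps k -> K0%:C <= `|k| ->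
     `|m1 (- k ^+ 2) - m2 (- k ^+ 2)|
       <= (C' a K0 eps delta s1 s2 * expR (- 2 * a * complex.Re k))%:C).
Proof.
exists (@decay_constant R), (@threshold R), (@low_constant R).
move=> a eps delta q1 q2 e1 e2 m1 m2 a0 eps0 d0 pot1 pot2 ae1 ae2 ad1 ad2 mf1 mf2 ae s1 s2.
have ad : 0 < a + delta by exact: addr_gt0.
have s10 : 0 <= s1 by apply: sup_local_L1_ge0 => //; exact: potential_integrable pot1 ad ad1.
have s20 : 0 <= s2 by apply: sup_local_L1_ge0 => //; exact: potential_integrable pot2 ad ad2.
have K1 : 1 <= threshold a eps delta s1 s2 by rewrite le_max lexx.
have high k : in_sector eps k -> threshold a eps delta s1 s2 <= normc k ->
    normc (m1 (- k ^+ 2) - m2 (- k ^+ 2)) <=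
    decay_constant eps delta s1 s2 * expR (- 2 * a * complex.Re k).
  by move=> sec; exact: (m_difference_high a0 eps0 d0 pot1 pot2 ae1 ae2 ad1 ad2 mf1 mf2 ae sec).
split; first split; first exact: lt_le_trans K1.
  by move=> k sec; rewrite !normr_normc !lecR; exact: high.
move=> K0 K00 k sec; rewrite !normr_normc !lecR => kK0.
have [g0 k0 _ _] := sector_bounds eps0 sec.
have E0 := expR_gt0 (- 2 * a * complex.Re k).
have dc0 : 0 <= decay_constant eps delta s1 s2.
  by rewrite /decay_constant mulr_ge0 ?expR_ge0 // mulr_ge0 // addr_ge0 ?Omega_ge0.
have b0 s : 0 <= s -> 0 <= small_energy_bound (threshold a eps delta s1 s2) K0 eps delta s.
  move=> s0; rewrite invr_ge0 ltW // m_eta_gt0 ?sqr_ge0 //.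
  by rewrite !mulr_gt0 ?exprn_gt0.
have b10 := b0 _ s10; have b20 := b0 _ s20.
have bb0 := addr_ge0 b10 b20.
have tail0 := mulr_ge0 bb0 (expR_ge0 (2 * a * threshold a eps delta s1 s2)).
(* Below the threshold the two m-functions are bounded separately; the factor [expR (2 * a * K)] in
   [low_constant] offsets [exp(- 2 a Re k)] because [Re k <= |k| <= K]. *)
have [le|/ltW le] := leP (threshold a eps delta s1 s2) (normc k).
  apply: le_trans (high k sec le) _; apply: ler_wpM2r; first exact: ltW.
  by rewrite /low_constant lerDl; exact: tail0.
have B1 := m_function_low a0 eps0 d0 pot1 ae1 ad1 mf1 sec K00 kK0 le.
have B2 := m_function_low a0 eps0 d0 pot2 ae2 ad2 mf2 sec K00 kK0 le.
apply: le_trans (le_normcD _ _) _; rewrite normcN; apply: le_trans (lerD B1 B2) _.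
rewrite /low_constant mulrDl -[leLHS]add0r; apply: lerD.
  by apply: mulr_ge0 dc0 (ltW E0).
rewrite -[leRHS]mulrA -expRD; apply: ler_peMr bb0 _.
rewrite -[leLHS]expR0 ler_expR.
have Rk : complex.Re k <= threshold a eps delta s1 s2.
  by apply: le_trans le; exact: le_trans (ler_norm _) (normr_Re_le k).
have -> : - 2 * a * complex.Re k = - (2 * a * complex.Re k) by ring.
by rewrite subr_ge0 ler_wpM2l // mulr_ge0 // ltW.
Qed.
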